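(* Let $m\ge1$ and $D=\sum_{i=0}^n\alpha_iD_i$ a $\mathbb{Q}$-divisor on $\mathbb{P}^m=\operatorname{Proj}k[x_0,\dots,x_m]$ with $D_i=V(f_i)$ distinct prime divisors, $f_i$ irreducible homogeneous of degree $a_i$, $\alpha_i=c_i/k_i\in\mathbb{Q}$ in lowest terms (with $\alpha_i=0$ allowed, written $0/1$), and $\deg D=\sum_i\alpha_ia_i>0$. Suppose $\{f_0,\dots,f_n\}$ contains $m+1$ linearly independent linear forms. Let $\ell_i=\operatorname{lcm}_{j\ne i}(k_j)$. Then $R_D$ is generated as a $k$-algebra in degrees at most $\sum_{i=0}^n\ell_ia_i$, and its relations are generated in degrees at most $\max\Big(2\sum_{i=0}^n\ell_ia_i,\ \frac{\max_{0\le i\le n}a_i}{\deg D}+\sum_{i=0}^n\ell_ia_i\Big).$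
   Context: $k$ is algebraically closed. $R_D=\bigoplus_{d\ge0}u^dH^0(\mathbb{P}^m,\lfloor dD\rfloor)$, graded by $d$ ($u$ formal), where $\lfloor\cdot\rfloor$ floors each coefficient and $H^0(X,E)=\{g\in k(X)^\times:\operatorname{div}(g)+E\ge0\}\cup\{0\}$. ''Relations generated in degrees at most $M$'' means: for a minimal set of homogeneous algebra generators $g_1,\dots,g_r$ of $R_D$, the kernel of $k[w_1,\dots,w_r]\to R_D$, $w_i\mapsto g_i$ ($\deg w_i=\deg g_i$), is generated by homogeneous elements of degree at most $M$. *)

(* Defs.v *)
From HB Require Import structures.
From mathcomp Require Import all_boot all_order all_algebra.
From mathcomp Require Import fraction.
From mathcomp Require Import mpoly.
Set Implicit Arguments. Unset Strict Implicit. Unset Printing Implicit Defensive.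
Import Order.TTheory GRing.Theory Num.Theory.
Local Open Scope ring_scope.

Section ProjSpace.
Variables (k : closedFieldType) (m : nat).

Definition Sring := {mpoly k[m.+1]}.
(* Its fraction field; the function field k(P^m) is its degree-0 part. *)
Definition Kfield := {fraction {mpoly k[m.+1]}}.

Definition mdivides (a b : {mpoly k[m.+1]}) : Prop := exists c, b = a * c.

Definition mirreducible (f : {mpoly k[m.+1]}) : Prop :=
  (1 < msize f)%N /\
  forall g h : {mpoly k[m.+1]}, f = g * h -> (msize g <= 1)%N \/ (msize h <= 1)%N.

Definition mhomog (f : {mpoly k[m.+1]}) : Prop := exists d, f \is d.-homog.

(* V(f) = V(g) for irreducible f, g: f and g are associate *)
Definition massoc (f g : {mpoly k[m.+1]}) : Prop := exists c : k, c != 0 /\ f = c *: g.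

Definition is_mult (F p : {mpoly k[m.+1]}) (e : nat) : Prop :=
  mdivides (F ^+ e) p /\ ~ mdivides (F ^+ e.+1) p.

Definition is_ord (F : {mpoly k[m.+1]}) (g : Kfield) (z : int) : Prop :=
  exists (p q : {mpoly k[m.+1]}) (e1 e2 : nat),
    p != 0 /\ q != 0 /\ g = tofrac p / tofrac q :> Kfield /\
    is_mult F p e1 /\ is_mult F q e2 /\ z = (e1%:Z - e2%:Z).

Definition in_funfield (g : Kfield) : Prop :=
  exists (p q : {mpoly k[m.+1]}) (d : nat),
    p \is d.-homog /\ q \is d.-homog /\ q != 0 /\ g = tofrac p / tofrac q.

(* H^0(P^m, E) = {g in k(X)^x : div g + E >= 0} u {0} *)
Definition H0 (n : nat) (f : 'I_n.+1 -> {mpoly k[m.+1]}) (e : 'I_n.+1 -> int)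
  (g : Kfield) : Prop :=
  g = 0 \/
  (g != 0 /\ in_funfield g /\
   forall F : {mpoly k[m.+1]}, mirreducible F -> mhomog F ->
     forall z, is_ord F g z ->
       (* coefficient of div g + E at V(F) is nonnegative; the coefficient
          of E at V(F) is e i if V(F) = V(f i), and 0 if V(F) is no V(f i) *)
       (forall i, massoc F (f i) -> 0 <= z + e i) /\
       ((forall i, ~ massoc F (f i)) -> 0 <= z)).

Definition kconst (c : k) : {poly Kfield} := (tofrac (c%:MP_[m.+1]) : Kfield)%:P.

(* The section ring R_D realized inside K[u]: P = sum_d u^d g_d with
   g_d in H^0(P^m, floor(d D)). *)
Definition in_RD (n : nat) (f : 'I_n.+1 -> {mpoly k[m.+1]}) (alpha : 'I_n.+1 -> rat)
  (P : {poly Kfield}) : Prop :=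
  forall d : nat, H0 f (fun i => Num.floor (d%:R * alpha i)) P`_d.

Definition homog_deg (P : {poly Kfield}) (d : nat) : Prop :=
  exists c : Kfield, P = c%:P * 'X^d.

Inductive in_kalg (S : {poly Kfield} -> Prop) : {poly Kfield} -> Prop :=
| alg_const c : in_kalg S (kconst c)
| alg_gen x : S x -> in_kalg S x
| alg_add x y : in_kalg S x -> in_kalg S y -> in_kalg S (x + y)
| alg_mul x y : in_kalg S x -> in_kalg S y -> in_kalg S (x * y).

End ProjSpace.

Definition whomog (k : fieldType) (r : nat) (wt : 'I_r -> nat) (P : {mpoly k[r]})
  (e : nat) : Prop :=
  forall mo, mo \in msupp P -> (\sum_(j < r) mo j * wt j)%N = e.

(* Main.v *)
Require Import Defs.
From Stdlib Require Import Classical ClassicalEpsilon.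
From HB Require Import structures.
From mathcomp Require Import all_boot all_order all_algebra.
From mathcomp Require Import fraction ssrcomplements.
From mathcomp Require Import mpoly.
From mathcomp Require Import ring zify.
Set Implicit Arguments. Unset Strict Implicit. Unset Printing Implicit Defensive.
Import Order.TTheory GRing.Theory Num.Theory.
Local Open Scope ring_scope.

(* Clearing denominators, R_D is spanned by the Laurent monomials u^d prod f_i^(c_i)
   with sum c_i a_i = 0 and c_i + d alpha_i >= 0: the linear forms among the f_i
   generate k[x], so every numerator is a polynomial in the f_i.  The exponents
   (d, c) form the lattice points of a simplicial cone, whose i-th ray contains
   the lattice point of degree l_i a_i with a single nonzero coordinate
   c_i + d alpha_i = l_i deg D.  Subtracting ray points leaves a remainder in the
   half-open parallelepiped they span, which has degree < L = sum l_i a_i; this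
   bounds the generators.
   For the relations, modulo those of degree <= 2L any two lifted monomials
   multiply like their exponents, so the relation ideal is reached by the kernel
   of k[y] -> k[x], y_i |-> f_i.  That kernel is generated by the polynomials
   y_i - phi(f_i), where phi writes x in terms of the linear forms.  A monomial
   multiple of such a generator is given by a lattice point with
   sum c_j a_j = - a_i; subtracting ray points again, its degree drops below
   a_i / deg D + L. *)

(** * Gauss's lemma *)

Section Factoriality.
Implicit Types R S : idomainType.

Definition divides R (a b : R) := exists c, b = a * c.

Definition prime_elt R (p : R) :=
  [/\ p != 0, p \isn't a GRing.unit &
      forall a b, divides p (a * b) -> divides p a \/ divides p b].

(** Factors are prime rather than irreducible, which builds uniqueness into the notion and leaves
    only existence to prove. *)
Definition factorization R (x : R) :=
  exists (u : R) (s : seq R),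
    [/\ u \is a GRing.unit, forall p, p \in s -> prime_elt p & x = u * \prod_(p <- s) p].

Definition is_factorial R := forall x : R, x != 0 -> factorization x.

Lemma factorizationM R (x y : R) :
  factorization x -> factorization y -> factorization (x * y).
Proof.
move=> [u [s [uu sp ->]]] [v [t [uv tp ->]]]; exists (u * v), (s ++ t).
split; first by rewrite unitrM uu.
  by move=> p; rewrite mem_cat => /orP[/sp|/tp].
by rewrite big_cat mulrACA.
Qed.

Lemma factorization_unit R (x : R) : x \is a GRing.unit -> factorization x.
Proof. by move=> ux; exists x, [::]; split=> //; rewrite big_nil mulr1. Qed.

Lemma factorization_prime R (x : R) : prime_elt x -> factorization x.
Proof.
move=> px; exists 1, [:: x]; split; first exact: unitr1.
  by move=> p; rewrite inE => /eqP->.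
by rewrite big_seq1 mul1r.
Qed.

Lemma prime_divides_prod R (p : R) (s : seq R) :
  prime_elt p -> divides p (\prod_(q <- s) q) -> exists2 q, q \in s & divides p q.
Proof.
move=> pp; elim: s => [|q s IH].
  rewrite big_nil => -[c pc]; case: pp => _ /negP[].
  by apply/unitrP; exists c; split; rewrite // mulrC.
rewrite big_cons; case: (pp) => _ _ pab /pab[pq|/IH[q' qs pq]].
  by exists q; rewrite ?mem_head.
by exists q' => //; rewrite inE qs orbT.
Qed.

Lemma divides_unitM R (p u x : R) :
  u \is a GRing.unit -> divides p (u * x) -> divides p x.
Proof. by move=> uu [c e]; exists (u^-1 * c); rewrite mulrCA -e mulKr. Qed.

Lemma prime_divides_sym R (p q : R) :
  prime_elt p -> prime_elt q -> divides p q -> divides q p.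
Proof.
move=> [p0 pu _] [q0 _ qab] [w e].
have [|//|[w' e']] := qab p w; first by exists 1; rewrite mulr1.
have pw : p * w' = 1 by apply: (mulfI q0); rewrite mulr1 mulrCA -e' -e.
by case/negP: pu; apply/unitrP; exists w'; split; rewrite // mulrC.
Qed.

(** If p divides neither f nor g, take the least i and j for which it does not divide f_i and g_j.
    Modulo p the coefficient of f g at i + j is f_i g_j, against primality of p. *)
Lemma prime_polyC R (p : R) : prime_elt p -> prime_elt (p%:P : {poly R}).
Proof.
move=> pp; case: (pp) => p0 pu pab; split; first by rewrite polyC_eq0.
  by rewrite poly_unitE coefC eqxx (negPf pu) andbF.
have dvdC (f : {poly R}) : (forall i, divides p f`_i) -> divides p%:P f.
  move=> h; suff H (n : nat) : exists c : {poly R}, forall i, (i < n)%N -> f`_i = p * c`_i.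
    have [c hc] := H (size f); exists (\poly_(i < size f) c`_i).
    apply/polyP=> i; rewrite coefCM coef_poly; case: ltnP => [/hc//|hi].
    by rewrite mulr0 nth_default.
  elim: n => [|n [c hc]]; first by exists 0.
  have [a ha] := h n; exists (\poly_(i < n.+1) (if i == n then a else c`_i)).
  move=> i hi; rewrite coef_poly hi; case: eqP => [->//|/eqP ne].
  by rewrite hc // ltn_neqAle ne -ltnS.
move=> f g [c e]; apply: NNPP => /not_or_and[nf ng].
have ex (h : {poly R}) : ~ divides p%:P h -> exists i, ~ divides p h`_i.
  by move=> nh; apply: not_all_ex_not => /dvdC.
have exm (h : {poly R}) : ~ divides p%:P h ->
    exists i, ~ divides p h`_i /\ forall j, (j < i)%N -> divides p h`_j.
  move/ex => [i]; elim/ltn_ind: i => i IH hi.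
  have [[j ji hj]|no] := classic (exists2 j, (j < i)%N & ~ divides p h`_j).
    exact: IH hj.
  by exists i; split=> // j ji; apply: NNPP => hj; apply: no; exists j.
have [i [fi fl]] := exm _ nf; have [j [gj gl]] := exm _ ng.
have dD (x y : R) : divides p x -> divides p y -> divides p (x + y).
  by move=> [a ->] [b ->]; exists (a + b); rewrite mulrDr.
have : divides p (f * g)`_(i + j) by exists c`_(i + j); rewrite e coefCM.
rewrite coefM (bigD1 (inord i)) //= inordK ?ltnS ?leq_addr // addKn => -[d hd].
have: divides p (f`_i * g`_j).
  have -> : f`_i * g`_j = p * d + - (\sum_(i0 < (i + j).+1 | i0 != inord i) f`_i0 * g`_(i + j - i0)).
    by rewrite -hd addrK.
  apply: (dD _ _); first by exists d.
  rewrite -sumrN; apply: (big_ind (divides p)); [by exists 0; rewrite mulr0 | exact: dD|].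
  move=> l ne.
  have [li|il] := ltnP l i.
    by have [a ->] := fl _ li; exists (- (a * g`_(i + j - l))); rewrite mulrN mulrA.
  have il' : (i < l)%N.
    rewrite ltn_neqAle il andbT; apply: contra ne => /eqP eil.
    by apply/eqP/val_inj; rewrite /= inordK -?eil ?ltnS ?leq_addr.
  have [|a ->] := gl (i + j - l)%N.
    by have := ltn_ord l; rewrite ltnS => lt; rewrite ltn_subLR // ltn_add2r.
  by exists (- (f`_l * a)); rewrite mulrN mulrCA.
by case/pab.
Qed.

(** The primes of c are peeled off one by one: each stays prime as a constant polynomial, so it
    divides g or h and is charged to that factor. *)
Lemma split_constant_factor R (c : R) (f g h : {poly R}) :
  c != 0 -> factorization c -> c *: f = g * h ->
  exists (a b : R) (g' h' : {poly R}),
    [/\ a != 0, b != 0, g = a *: g', h = b *: h' & f = g' * h'].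
Proof.
move=> c0 [u [s [uu sp ec]]]; subst c.
elim: s sp c0 f g h => [|p s IH] sp c0 f g h.
  rewrite big_nil mulr1 => e; exists u, 1, (u^-1 *: g), h.
  rewrite oner_neq0 scale1r scalerA divrr // scale1r; split=> //.
    by apply: contraTneq uu => ->; rewrite unitr0.
  by rewrite -scalerAl -e scalerA mulVr // scale1r.
have pp : prime_elt p by apply: sp; rewrite mem_head.
have sp' q : q \in s -> prime_elt q by move=> qs; apply: sp; rewrite inE qs orbT.
have p0 : p != 0 by case: pp.
move: c0; rewrite big_cons mulrCA => c0.
have c0' : u * \prod_(q <- s) q != 0 by apply: contra_neq c0 => ->; rewrite mulr0.
rewrite -scalerA => e.
have pC0 : p%:P != 0 by rewrite polyC_eq0.
have := prime_polyC pp; case=> _ _ /(_ g h) [|[g1 eg]|[h1 eh]].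
- by exists ((u * \prod_(q <- s) q) *: f); rewrite mul_polyC e.
- have e1 : (u * \prod_(q <- s) q) *: f = g1 * h.
    by apply: (mulfI pC0); rewrite mul_polyC e eg mulrA.
  have [a [b [g' [h' [a0 b0 eg1 -> ->]]]]] := IH sp' c0' _ _ _ e1.
  exists (p * a), b, g', h'; split=> //; first by rewrite mulf_neq0.
  by rewrite -scalerA -mul_polyC eg eg1.
- have e1 : (u * \prod_(q <- s) q) *: f = g * h1.
    by apply: (mulfI pC0); rewrite mul_polyC e eh mulrCA.
  have [a [b [g' [h' [a0 b0 -> eh1 ->]]]]] := IH sp' c0' _ _ _ e1.
  exists a, (p * b), g', h'; split=> //; first by rewrite mulf_neq0.
  by rewrite -scalerA -mul_polyC eh eh1.
Qed.

Definition primitive_poly R (f : {poly R}) :=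
  forall c (f' : {poly R}), f = c *: f' -> c \is a GRing.unit.

(** Only primes of the leading coefficient can divide f. Each is either divided out of f or set
    aside; once all are treated, a prime constant dividing f would be associate to one set aside. *)
Lemma primitive_part R (f : {poly R}) : is_factorial R -> f != 0 ->
  exists c f', [/\ c != 0, f = c *: f' & primitive_poly f'].
Proof.
move=> PF f0; have lf0 : lead_coef f != 0 by rewrite lead_coef_eq0.
have [u [s [uu sp]]] := PF _ lf0.
(* [t] collects the primes found not to divide f, starting from the empty list; the induction keeps
   the leading coefficient equal to [u] times both products. *)
have [t] : exists t : seq R, [/\ forall p, p \in t -> prime_elt p,
    forall p, p \in t -> ~ divides p%:P f & 
    u * \prod_(p <- s) p = u * \prod_(p <- s) p * \prod_(p <- t) p].
  by exists [::]; split; rewrite // big_nil mulr1.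
case=> tp tf -> {lf0}.
elim: s sp f f0 t tp tf => [|p s IH] sp f f0 t tp tf.
  rewrite big_nil mulr1 => lf; exists 1, f; rewrite oner_neq0 scale1r; split=> //.
  move=> c f' e; have c0 : c != 0 by apply: contra_neq f0 => c0; rewrite e c0 scale0r.
  have [v [[|q r] [uv rp ec]]] := PF _ c0; first by rewrite ec big_nil mulr1.
  have pq : prime_elt q by apply: rp; rewrite mem_head.
  have qf : divides q%:P f.
    exists ((v * \prod_(x <- r) x) *: f').
    by rewrite e ec big_cons mul_polyC scalerA mulrCA.
  have : divides q (u * \prod_(p <- t) p).
    by case: qf => g eg; exists (lead_coef g); rewrite -lf eg lead_coefM lead_coefC.
  move/(divides_unitM uu)/(prime_divides_prod pq) => [p pt qp].
  have [w ew] := prime_divides_sym pq (tp _ pt) qp.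
  case: (tf p pt); case: qf => g ->; exists (w%:P * g).
  by rewrite ew polyCM mulrA.
have pp : prime_elt p by apply: sp; rewrite mem_head.
have sp' q : q \in s -> prime_elt q by move=> qs; apply: sp; rewrite inE qs orbT.
have p0 : p != 0 by case: pp.
rewrite big_cons => lf.
have [[f1 ef]|nf] := classic (divides p%:P f).
  have f10 : f1 != 0 by apply: contra_neq f0 => z; rewrite ef z mulr0.
  have [||c [f' [c0 e1 pf]]] := IH sp' f1 f10 t tp.
  - by move=> q qt [g eg]; apply: (tf q qt); exists (p%:P * g); rewrite ef eg mulrCA.
  - by apply: (mulfI p0); rewrite -[p in LHS]lead_coefC -lead_coefM -ef lf mulrCA !mulrA.
  exists (p * c), f'; split=> //; first by rewrite mulf_neq0.
  by rewrite ef e1 mul_polyC scalerA.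
apply: (IH sp' f f0 (p :: t)).
- by move=> q; rewrite inE => /orP[/eqP->|/tp].
- by move=> q; rewrite inE => /orP[/eqP->|/tf].
- by rewrite big_cons lf [p * _]mulrC !mulrA.
Qed.

Import Pdiv.Idomain.

(** Removes the constant introduced by pseudo-division: the share of c that falls to the primitive f
    is a unit. *)
Lemma primitive_dividesZ R (f h : {poly R}) c : is_factorial R -> primitive_poly f ->
  c != 0 -> divides f (c *: h) -> divides f h.
Proof.
move=> PF pf c0 [g e]; have [a [b [f' [g' [a0 b0 ef _ ->]]]]] := split_constant_factor c0 (PF _ c0) e.
have ua := pf _ _ ef; exists (a^-1 *: g').
by rewrite ef -scalerAr -scalerAl scalerA mulVr // scale1r.
Qed.

(* Gauss's lemma: a primitive polynomial that is not prime is a product of two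
   polynomials of smaller degree, obtained from a pseudo-gcd by distributing
   the prime factors of the pseudo-division constant. *)
Lemma factorial_poly R : is_factorial R -> is_factorial {poly R}.
Proof.
move=> PF f; have [n le] := ubnP (size f); elim: n f le => // n IH f le f0.
have PFC c : c != 0 -> factorization (c%:P : {poly R}).
  move=> /PF[u [s [uu sp ->]]]; exists u%:P, [seq p%:P | p <- s]; split.
  - exact: rmorph_unit.
  - by move=> _ /mapP[p ps ->]; apply/prime_polyC/sp.
  - by rewrite polyCM big_map rmorph_prod.
have [c [f1 [c0 ef pf]]] := primitive_part PF f0.
have f10 : f1 != 0 by apply: contra_neq f0 => z; rewrite ef z scaler0.
rewrite ef -mul_polyC; apply: factorizationM; first exact: PFC.
move: le; rewrite ef size_scale // => le {f f0 ef c c0}.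
have [s1|s1] := leqP (size f1) 1.
  by rewrite (size1_polyC s1); apply: PFC; rewrite -polyC_eq0 -size1_polyC.
have [|np] := classic (prime_elt f1); first exact: factorization_prime.
have nu : f1 \isn't a GRing.unit by rewrite poly_unitE; case: eqP s1 => // ->.
have [g [h [dgh ng nh]]] : exists g h, [/\ divides f1 (g * h), ~ divides f1 g & ~ divides f1 h].
  apply: NNPP => no; apply: np; split=> // g h gh; apply: NNPP => /not_or_and[a b].
  by apply: no; exists g, h.
have dvd_div x : f1 %| x -> divides f1 x.
  case/dvdpP => -[a q] /= a0 e; apply: (primitive_dividesZ PF pf a0).
  by exists q; rewrite e mulrC.
have dvd_pdiv x : divides f1 x -> f1 %| x by case=> q ->; apply: dvdp_mulr.
(* [d] is a proper factor of [f1]: were it constant, [f1] would be coprime to g and divide h; were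
   its degree that of [f1], [f1] would divide g. *)
pose d := gcdp f1 g.
have df : d %| f1 by apply: dvdp_gcdl.
have d0 : d != 0 by apply: contraNneq f10 => d0; move: df; rewrite d0 dvd0p.
have sd1 : (1 < size d)%N.
  rewrite ltn_neqAle size_poly_gt0 d0 andbT eq_sym -coprimep_def.
  apply/negP => cop; case: nh; apply: dvd_div.
  by rewrite -(Gauss_dvdpr _ cop) dvd_pdiv.
have sdf : (size d < size f1)%N.
  rewrite ltn_neqAle dvdp_leq // andbT (dvdp_size_eqp df).
  apply/negP => eqd; case: ng; apply: dvd_div.
  by rewrite -(eqp_dvdl _ eqd) dvdp_gcdr.
case/dvdpP: df => -[a e] /= a0 eqf.
have [b1 [b2 [e' [d' [b10 b20 ee ed ff]]]]] := split_constant_factor a0 (PF _ a0) eqf.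
have sd' : size d' = size d by rewrite ed size_scale.
have e'0 : e' != 0 by apply: contra_neq f10 => z; rewrite ff z mul0r.
have d'0 : d' != 0 by apply: contra_neq f10 => z; rewrite ff z mulr0.
have se : size f1 = (size e' + size d').-1 by rewrite ff size_mul.
rewrite ff; apply: factorizationM; apply: IH => //.
  rewrite sd' in se; rewrite -(ltn_add2r (size d)).
  apply: leq_trans (_ : size f1 + 2 <= _)%N.
    by rewrite se addn2 prednK // addn_gt0 size_poly_gt0 e'0.
  by rewrite leq_add // -ltnS.
by rewrite sd'; apply: leq_trans sdf _; rewrite -ltnS.
Qed.

Lemma factorial_transfer R S (phi : {rmorphism R -> S}) :
  injective phi -> (forall y, exists x, phi x = y) -> is_factorial S -> is_factorial R.
Proof.
move=> inj sur PF x x0.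
have px0 : phi x != 0 by rewrite -(rmorph0 phi) (inj_eq inj).
have unitE z : (phi z \is a GRing.unit) = (z \is a GRing.unit).
  apply/idP/idP; last exact: rmorph_unit.
  case/unitrP => y [h1 h2]; have [z' e] := sur y; apply/unitrP; exists z'.
  by split; apply: inj; rewrite rmorphM rmorph1 e.
have divE a b : divides (phi a) (phi b) -> divides a b.
  case=> c e; have [c' ec] := sur c; exists c'.
  by apply: inj; rewrite rmorphM ec.
have primeE z : prime_elt (phi z) -> prime_elt z.
  case=> z0 zu zp; split; first by rewrite -(inj_eq inj) rmorph0.
    by rewrite -unitE.
  move=> a b [c e]; have [|/divE|/divE] := zp (phi a) (phi b); auto.
  by exists (phi c); rewrite -!rmorphM e.
have [u [s [uu sp e]]] := PF _ px0; have [u' eu] := sur u.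
have [s' es] : exists s', s = [seq phi z | z <- s'].
  elim: s {sp e} => [|y s [s' ->]]; first by exists [::].
  by have [z <-] := sur y; exists (z :: s').
exists u', s'; split.
- by rewrite -unitE eu.
- by move=> p ps; apply/primeE/sp; rewrite es map_f.
- by apply: inj; rewrite rmorphM rmorph_prod e eu es big_map.
Qed.

End Factoriality.

(** * Factoriality of polynomial rings and homogeneous factors *)

Section PolynomialFactoriality.
Variable k : fieldType.

Lemma mcoeff_muni n (p : {mpoly k[n.+1]}) (m : 'X_{1..n.+1}) :
  (muni p)`_(m ord_max)@_[multinom m (widen_ord (leqnSn n) i) | i < n] = p@_m.
Proof.
rewrite muniE coef_sum raddf_sum /= [in RHS](mpolyE p) [in RHS]raddf_sum /=.
apply: eq_bigr => m' _; rewrite !coefZ coefXn [RHS]mcoeffZ mcoeffX; case: eqP => [e|ne].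
  rewrite mulr1 mcoeffZ mcoeffX; congr (_ * _%:R); congr nat_of_bool.
  apply/eqP/eqP => [/mnmP h|-> //]; apply/mnmP => i.
  case: (unliftP ord_max i) => [j ->|->]; last by rewrite e.
  have := h j; rewrite !mnmE.
  suff -> : lift ord_max j = widen_ord (leqnSn n) j by [].
  by apply: val_inj; rewrite /= /bump leqNgt ltn_ord.
rewrite mulr0 mcoeff0; case: eqP => [em|]; last by rewrite mulr0.
by case: ne; rewrite em.
Qed.

Lemma muni_inj n : injective (@muni n k).
Proof. by move=> p q e; apply/mpolyP => m; rewrite -!mcoeff_muni e. Qed.

Lemma muni_surj n (y : {poly {mpoly k[n]}}) : exists x, muni x = y.
Proof.
have muniX : muni ('X_ord_max : {mpoly k[n.+1]}) = 'X.
  rewrite muniE msuppX big_seq1 mcoeffX eqxx scale1r mnm1E eqxx expr1.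
  suff -> : [multinom U_(ord_max)%MM (widen_ord (leqnSn n) i) | i < n] = 0%MM.
    by rewrite mpolyX0 scale1r.
  apply/mnmP => i; rewrite mnmE mnm1E mnm0E.
  by apply/eqP; rewrite eqb0 -val_eqE /= neq_ltn ltn_ord orbT.
have muniW (p : {mpoly k[n]}) : muni (mwiden p) = p%:P.
  elim/mpolyind: p => [|c m p _ _ IH]; first by rewrite mwiden0 muni0.
  rewrite mwidenD muniD IH polyCD; congr (_ + _).
  rewrite -mul_mpolyC mwidenM mwidenC mwidenX muniM muniC polyCM; congr (_ * _).
  rewrite muniE msuppX big_seq1 mcoeffX eqxx scale1r mnmwiden_ordmax expr0.
  rewrite alg_polyC; congr (_ %:P); congr 'X_[_].
  by apply/mnmP => i; rewrite mnmE mnmwiden_widen.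
elim/poly_ind: y => [|y c [x ex]]; first by exists 0; rewrite muni0.
by exists (x * 'X_ord_max + mwiden c); rewrite muniD muniM ex muniX muniW.
Qed.

Lemma factorial_mpoly n : is_factorial {mpoly k[n]}.
Proof.
elim: n => [p p0|n IH].
  apply: factorization_unit; apply/unitrP.
  have e : p = (p@_0)%:MP.
    apply/mpolyP => m; rewrite mcoeffC.
    have -> : m = 0%MM by apply/mnmP => -[].
    by rewrite eqxx mulr1.
  have c0 : p@_0 != 0 by apply: contra_neq p0 => z; rewrite e z.
  by exists (p@_0)^-1%:MP; rewrite e -!mpolyCM mpolyCK mulVf ?mulfV.
exact: (factorial_transfer (@muni_inj n) (@muni_surj n) (factorial_poly IH)).
Qed.

End PolynomialFactoriality.

(** * Factors of homogeneous polynomials are homogeneous *)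

Section HomogeneousFactors.
Variables (k : fieldType) (n : nat).
Implicit Types p q : {mpoly k[n]}.

(** While d > 0, evaluation at 0 shows that the indeterminate divides P or Q, and it is cancelled
    there; for d = 0 both factors are constants. *)
Lemma factor_monomial (A : idomainType) (P Q : {poly A}) c d : c != 0 ->
  P * Q = c%:P * 'X^d -> exists a e, P = a%:P * 'X^e.
Proof.
have X0 : 'X != 0 :> {poly A} by rewrite -size_poly_eq0 size_polyX.
move=> c0; elim: d P Q => [|d IH] P Q e.
  have: P * Q != 0 by rewrite e expr0 mulr1 polyC_eq0.
  rewrite mulf_eq0 negb_or => /andP[P0 Q0].
  have := congr1 (size : {poly A} -> nat) e; rewrite size_mul // expr0 mulr1 size_polyC c0 => s1.
  exists (P`_0), 0%N; rewrite expr0 mulr1 -size1_polyC //.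
  move: s1 P0 Q0; rewrite -!size_poly_gt0; lia.
have : (P * Q).[0] = 0 by rewrite e !hornerE expr0n mulr0.
rewrite hornerM => /eqP; rewrite mulf_eq0 => /orP[] /factor_theorem[R eR];
  rewrite polyC0 subr0 in eR.
  have [|a [j ea]] := IH R Q.
    by apply: (mulIf X0); rewrite mulrAC -eR e exprSr mulrA.
  by exists a, j.+1; rewrite eR ea exprSr mulrA.
have [|a [j ea]] := IH P R.
  by apply: (mulIf X0); rewrite -mulrA -eR e exprSr mulrA.
by exists a, j.
Qed.

(* p(x) becomes p(t x), which is c t^d exactly when p is d-homogeneous. *)
Definition grading_poly p : {poly {mpoly k[n]}} :=
  mmap (polyC \o @mpolyC n k) (fun i => ('X_i)%:P * 'X) p.

Lemma grading_polyE p :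
  grading_poly p = \sum_(m <- msupp p) (p@_m *: 'X_[m])%:P * 'X^(mdeg m).
Proof.
apply: eq_bigr => m _ /=; rewrite -mul_mpolyC polyCM -mulrA; congr (_ * _).
rewrite /mmap1 mdegE mpolyXE_id rmorph_prod /= -prodrXr -big_split /=.
by apply: eq_bigr => i _; rewrite exprMn rmorphXn.
Qed.

(** [grading_poly] is multiplicative and sends p q to p q t^d, so by [factor_monomial] it sends p to
    some a t^j. Setting t = 1 gives a = p, and the coefficient of t^j shows that p is its own part
    of degree j. *)
Lemma dhomog_factor p q d : p * q != 0 -> p * q \is d.-homog ->
  exists e, p \is e.-homog.
Proof.
move=> pq0 pqd.
have e : grading_poly p * grading_poly q = (p * q)%:P * 'X^d.
  rewrite -rmorphM /= -/(grading_poly _) grading_polyE [in RHS](mpolyE (p * q)).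
  rewrite rmorph_sum /= mulr_suml; apply: eq_big_seq => m mpq.
  by move/dhomogP: pqd => /(_ _ mpq) ->.
have [a [j ep]] := factor_monomial pq0 e; exists j.
have pa : p = a.
  have := congr1 (horner^~ 1) ep; rewrite !hornerE expr1n mulr1 => <-.
  rewrite grading_polyE horner_sum {1}(mpolyE p); apply: eq_bigr => m _.
  by rewrite hornerM hornerC hornerXn expr1n mulr1.
have := congr1 (fun P : {poly _} => P`_j) ep.
rewrite /= coefCM coefXn eqxx mulr1 -pa grading_polyE => <-.
rewrite coef_sum; apply: rpred_sum => m _.
rewrite coefCM coefXn; case: eqP => [->|_]; last by rewrite mulr0 rpred0.
by rewrite mulr1 rpredZ // dhomogX.
Qed.

End HomogeneousFactors.

(** * Multiplicities along prime divisors *)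

Lemma divf_mul_cross (K : fieldType) (x y z w : K) : y != 0 -> w != 0 ->
  x / y = z / w -> x * w = z * y.
Proof. by move=> y0 w0 /eqP; rewrite eqr_div // => /eqP. Qed.

Section Valuations.
Variables (k : closedFieldType) (m : nat).
Notation S := {mpoly k[m.+1]}.
Notation K := (Kfield k m).
Implicit Types F G p q : S.

Lemma msize_le1_unit p : p != 0 -> (msize p <= 1)%N -> p \is a GRing.unit.
Proof.
move=> p0 /msize1_polyC e; rewrite e; apply: rmorph_unit.
by rewrite unitfE; apply: contra_neq p0 => z; rewrite e z.
Qed.

Lemma msize_mulS p q : p * q != 0 -> exists a b,
  [/\ msize p = a.+1, msize q = b.+1 & msize (p * q) = (a + b).+1].
Proof.
rewrite mulf_eq0 negb_or => /andP[p0 q0]; rewrite msizeM //.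
exists (msize p).-1, (msize q).-1.
have sp : (0 < msize p)%N by rewrite lt0n msize_poly_eq0.
have sq : (0 < msize q)%N by rewrite lt0n msize_poly_eq0.
by rewrite !prednK //; split=> //; case: (msize p) sp => // a _; case: (msize q) sq => // b _; rewrite addSn addnS.
Qed.

(** In a factorization of F into primes, irreducibility forces the cofactor of the first prime to be
    a unit, and primality passes to associates. *)
Lemma mirreducible_prime F : mirreducible F -> prime_elt F.
Proof.
case=> sF irr; have F0 : F != 0 by apply: contraTneq sF => ->; rewrite msize0.
have nu p : (1 < msize p)%N -> p \isn't a GRing.unit.
  move=> sp; apply/negP => /unitrP[q [e _]].
  have [|a [b [eq ep]]] := @msize_mulS q p; first by rewrite e oner_neq0.
  by rewrite e msize1 => -[/esym/eqP]; rewrite addn_eq0 => /andP[_ /eqP b0]; rewrite ep b0 in sp.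
have [u [s [uu sp e]]] := factorial_mpoly F0.
case: s sp e => [|p s] sp e; first by case/negP: (nu _ sF); rewrite e big_nil mulr1.
have [p0 pu pab] := sp p (mem_head _ _).
rewrite big_cons mulrCA in e.
have [|sr] := irr _ _ e; first by move/(msize_le1_unit p0); rewrite (negPf pu).
have r0 : u * \prod_(q <- s) q != 0 by apply: contra_neq F0 => z; rewrite e z mulr0.
have ur := msize_le1_unit r0 sr.
split; [by []|exact: nu|].
move=> a b [c ec]; have [|[d ->]|[d ->]] := pab a b.
- by exists ((u * \prod_(q <- s) q) * c); rewrite mulrA -e.
- by left; exists ((u * \prod_(q <- s) q)^-1 * d); rewrite {1}e -mulrA mulVKr.
- by right; exists ((u * \prod_(q <- s) q)^-1 * d); rewrite {1}e -mulrA mulVKr.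
Qed.

Lemma prime_mirreducible F : prime_elt F -> mirreducible F.
Proof.
case=> F0 Fu pF; split; first by rewrite ltnNge; apply: contra Fu => /(msize_le1_unit F0).
have unit_msize p q : F = F * p * q -> (msize q <= 1)%N.
  move=> e; have e1 : p * q = 1 by apply: (mulfI F0); rewrite mulr1 mulrA -e.
  have [|a [b [ep eq]]] := @msize_mulS p q; first by rewrite e1 oner_neq0.
  by rewrite e1 msize1 => -[/esym/eqP]; rewrite addn_eq0 eq => /andP[_ /eqP ->].
move=> g h e; have [|[w ew]|[w ew]] := pF g h; first by exists 1; rewrite e mulr1.
  by right; apply: (@unit_msize w); rewrite -ew.
by left; apply: (@unit_msize w); rewrite -ew mulrC.
Qed.

Lemma prime_divides_massoc F G : prime_elt F -> prime_elt G -> divides F G -> massoc F G.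
Proof.
move=> pF /prime_mirreducible[sG irr] [w e].
have [F0 Fu _] := pF; have [sF _] := prime_mirreducible pF.
have [|/msize1_polyC ew] := irr _ _ e; first by rewrite leqNgt sF.
have c0 : w@_0 != 0.
  by apply: contraTneq sG => z; rewrite e ew z mulr0 msize0.
exists (w@_0)^-1; rewrite invr_eq0; split=> //.
by rewrite e {2}ew mulrC mul_mpolyC scalerA mulVf // scale1r.
Qed.

Lemma is_multP F p e : F != 0 ->
  is_mult F p e <-> exists2 p', p = F ^+ e * p' & ~ divides F p'.
Proof.
move=> F0; have Fe0 : F ^+ e != 0 by rewrite expf_neq0.
split=> [[[p' e1] n]|[p' e1 n]].
  exists p' => // -[c ec]; apply: n; exists c.
  by rewrite e1 ec exprSr mulrA.
split; first by exists p'.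
case=> c ec; apply: n; exists c; apply: (mulfI Fe0).
by rewrite -e1 ec exprSr mulrA.
Qed.

Lemma is_mult_exists F p : prime_elt F -> p != 0 -> exists e, is_mult F p e.
Proof.
move=> pF; have [F0 _ _] := pF; have [sF _] := prime_mirreducible pF.
have [n] := ubnP (msize p); elim: n p => // n IH p le p0.
have [[c ec]|nd] := classic (divides F p); last first.
  by exists 0%N; apply/(is_multP _ _ F0); exists p; rewrite // mul1r.
have c0 : c != 0 by apply: contra_neq p0 => z; rewrite ec z mulr0.
have [||e /(is_multP _ _ F0)[p' e1 n1]] := IH c => //.
  have [|a [b [sa sb sab]]] := @msize_mulS F c; first by rewrite -ec.
  move: sF le; rewrite ec sab sb sa !ltnS; case: (a) => // a' _.
  by rewrite addSn; apply: leq_ltn_trans; rewrite ltnS leq_addl.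
exists e.+1; apply/(is_multP _ _ F0); exists p' => //.
by rewrite ec e1 exprS mulrA.
Qed.

Lemma is_multM F p q e1 e2 : prime_elt F ->
  is_mult F p e1 -> is_mult F q e2 -> is_mult F (p * q) (e1 + e2)%N.
Proof.
move=> pF; have [F0 _ pab] := pF.
move=> /(is_multP _ _ F0)[p' -> np] /(is_multP _ _ F0)[q' -> nq].
apply/(is_multP _ _ F0); exists (p' * q'); last by case/pab.
by rewrite exprD mulrACA.
Qed.

Lemma is_mult_divides F p e j : is_mult F p e -> divides (F ^+ j) p -> (j <= e)%N.
Proof.
move=> [_ n] [c ec]; rewrite leqNgt; apply/negP => lt; apply: n.
by exists (F ^+ (j - e.+1) * c); rewrite mulrA -exprD subnKC.
Qed.

Lemma is_mult_uniq F p e1 e2 : is_mult F p e1 -> is_mult F p e2 -> e1 = e2.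
Proof.
move=> h1 h2; apply/eqP; rewrite eqn_leq.
by apply/andP; split; [case: h1 => /(is_mult_divides h2)|case: h2 => /(is_mult_divides h1)].
Qed.

Lemma is_mult1 F : prime_elt F -> is_mult F 1 0.
Proof.
move=> [F0 Fu _]; apply/(is_multP _ _ F0); exists 1; first by rewrite mulr1.
by case=> c e; case/negP: Fu; apply/unitrP; exists c; rewrite mulrC.
Qed.

Lemma is_multX F p e j : prime_elt F -> is_mult F p e -> is_mult F (p ^+ j) (j * e)%N.
Proof.
move=> pF h; elim: j => [|j IH]; first by rewrite mul0n; apply: is_mult1.
by rewrite exprS mulSn; apply: is_multM.
Qed.

Lemma is_mult_prod (I : Type) (r : seq I) F (p : I -> S) (e : I -> nat) : prime_elt F ->
  (forall i, is_mult F (p i) (e i)) -> is_mult F (\prod_(i <- r) p i) (\sum_(i <- r) e i)%N.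
Proof.
move=> pF h; elim: r => [|i r IH]; first by rewrite !big_nil; apply: is_mult1.
by rewrite !big_cons; apply: is_multM.
Qed.

Lemma is_mult_assoc F G : prime_elt F -> massoc F G -> is_mult F G 1.
Proof.
move=> [F0 Fu _] a; apply/(is_multP _ _ F0); case: a => c [c0 e].
exists (c^-1)%:MP; first by rewrite mulrC mul_mpolyC expr1 e scalerA mulVf // scale1r.
case=> w ew; case/negP: Fu; apply/unitrP; exists (w * c%:MP).
have e1 : F * (w * c%:MP) = 1 by rewrite mulrA -ew -mpolyCM mulVf.
by split; rewrite // mulrC.
Qed.

Lemma is_mult_nassoc F G : prime_elt F -> prime_elt G -> ~ massoc F G -> is_mult F G 0.
Proof.
move=> pF pG na; have [F0 _ _] := pF; apply/(is_multP _ _ F0).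
by exists G; [rewrite mul1r|move/(prime_divides_massoc pF pG)].
Qed.

(** [is_ord] may use any fraction representing the function; cross-multiplying two of them and
    adding multiplicities shows that the choice does not matter. *)
Lemma is_ord_uniq F p q e1 e2 z : prime_elt F -> p != 0 -> q != 0 ->
  is_mult F p e1 -> is_mult F q e2 -> is_ord F (tofrac p / tofrac q : K) z ->
  z = e1%:Z - e2%:Z.
Proof.
move=> pF p0 q0 h1 h2 [p' [q' [e1' [e2' [p'0 [q'0 [e [h1' [h2' ->]]]]]]]]].
have q0' : tofrac q != 0 :> K by rewrite tofrac_eq0.
have q'0' : tofrac q' != 0 :> K by rewrite tofrac_eq0.
have eK : tofrac (p * q') = tofrac (p' * q) :> K.
  by rewrite [LHS]tofracM [RHS]tofracM; exact: divf_mul_cross q0' q'0' e.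
have e' : p * q' = p' * q by apply/eqP; rewrite -tofrac_eq; apply/eqP.
have := is_mult_uniq (is_multM pF h1 h2'); rewrite e' => /(_ _ (is_multM pF h1' h2)).
lia.
Qed.

(** Cancel a prime factor G of q from both sides. For F associate to G the hypothesis is used with
    exponent j + 1; along any other F, G has multiplicity 0 and leaves the exponent unchanged. *)
Lemma divides_by_mult p q : q != 0 ->
  (forall F j, prime_elt F -> divides (F ^+ j) q -> divides (F ^+ j) p) -> divides q p.
Proof.
move=> q0; have [u [s [uu sp e]]] := factorial_mpoly q0; rewrite {q q0}e.
elim: s sp p => [|G s IH] sp p h.
  by rewrite big_nil mulr1; exists (u^-1 * p); rewrite mulVKr.
have pG : prime_elt G by apply: sp; rewrite mem_head.
have [G0 _ _] := pG.
have [p' ep] : divides G p.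
  rewrite -[G]expr1; apply: h => //; exists (u * \prod_(q <- s) q).
  by rewrite big_cons mulrCA expr1.
have [||c ec] := IH _ p'; first by move=> F Fs; apply: sp; rewrite inE Fs orbT.
  move=> F j pF [c ec].
  have [|na] := classic (massoc F G).
    move=> [a [a0 ea]]; have Fj : F ^+ j = (a ^+ j)%:MP * G ^+ j.
      by rewrite ea exprZn mul_mpolyC.
    have aj0 : a ^+ j != 0 by rewrite expf_neq0.
    have [|d ed] := h G j.+1 pG.
      exists ((a ^+ j)%:MP * c); rewrite big_cons mulrCA ec Fj exprS; ring.
    exists ((a ^- j)%:MP * d); apply: (mulfI G0).
    rewrite -ep ed Fj exprS -mulrA; congr (_ * _).
    by rewrite mulrACA -mpolyCM mulfV // mul1r.
  have [|d ed] := h F j pF.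
    by exists (G * c); rewrite big_cons mulrCA ec mulrCA.
  have [->|p'0] := eqVneq p' 0; first by exists 0; rewrite mulr0.
  have [e he] := is_mult_exists pF p'0.
  have le : (j <= e)%N.
    apply: (is_mult_divides (is_multM pF (is_mult_nassoc pF pG na) he)).
    by rewrite -ep; exists d.
  have [F0 _ _] := pF; have [p'' -> _] := (is_multP _ _ F0).1 he.
  by exists (F ^+ (e - j) * p''); rewrite mulrA -exprD subnKC.
by exists c; rewrite ep ec big_cons; ring.
Qed.

End Valuations.

(** * Sections of divisors supported on the given forms *)

Section Weights.
Variables (n : nat) (a : 'I_n -> nat).

Definition wt (b : 'X_{1..n}) : nat := (\sum_(j < n) b j * a j)%N.

Lemma wt0 : wt 0%MM = 0%N.
Proof. by rewrite /wt big1 // => i _; rewrite mnm0E. Qed.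

Lemma wtD b c : wt (b + c)%MM = (wt b + wt c)%N.
Proof. by rewrite /wt -big_split; apply: eq_bigr => i _; rewrite mnmDE mulnDl. Qed.

HB.instance Definition _ := isMeasure.Build n wt wt0 wtD.

Lemma wt1 i : wt U_(i)%MM = a i.
Proof.
rewrite /wt (bigD1 i) //= mnm1E eqxx mul1n big1 ?addn0 // => j /negPf ne.
by rewrite mnm1E eq_sym ne.
Qed.

End Weights.

Definition posi (c : int) : nat := if c is Posz i then i else 0%N.
Definition negi (c : int) : nat := if c is Negz i then i.+1 else 0%N.

Lemma posi_negi c : c = (posi c)%:Z - (negi c)%:Z.
Proof. by case: c => i /=; lia. Qed.

Lemma exprz_posi_negi (K : fieldType) (x : K) c : x != 0 ->
  x ^ c = x ^+ posi c / x ^+ negi c.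
Proof. by move=> x0; rewrite {1}(posi_negi c) expfzDr // exprnN. Qed.

Lemma divf_factor (K : fieldType) (p q x y r : K) : q != 0 -> x != 0 -> y != 0 ->
  p * x = q * y * r -> p / q = r * (x / y)^-1.
Proof.
move=> q0 x0 y0 e; have -> : p = q * y * r / x by rewrite -e mulfK.
by field; rewrite x0 y0.
Qed.

Section Sections.
Variables (k : closedFieldType) (m n : nat).
Notation S := {mpoly k[m.+1]}.
Notation K := (Kfield k m).
Variables (f : 'I_n.+1 -> S) (a : 'I_n.+1 -> nat).
Hypothesis f_irr : forall i, mirreducible (f i).
Hypothesis f_hom : forall i, f i \is (a i).-homog.
Hypothesis f_na : forall i j, i != j -> ~ massoc (f i) (f j).

Let f_prime i : prime_elt (f i). Proof. exact: mirreducible_prime. Qed.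
Lemma form_neq0 i : f i != 0. Proof. by case: (f_prime i). Qed.

Lemma form_frac_neq0 i : tofrac (f i) != 0 :> K.
Proof. by rewrite tofrac_eq0 form_neq0. Qed.

Definition fpow (c : 'I_n.+1 -> int) : K := \prod_i (tofrac (f i) : K) ^ c i.

Lemma fpow_neq0 c : fpow c != 0.
Proof. by apply/prodf_neq0 => i _; rewrite expfz_neq0 // form_frac_neq0. Qed.

Lemma fpowD c c' : fpow (fun i => c i + c' i) = fpow c * fpow c'.
Proof.
by rewrite -big_split; apply: eq_bigr => i _; rewrite expfzDr // form_frac_neq0.
Qed.

Lemma eq_fpow c c' : c =1 c' -> fpow c = fpow c'.
Proof. by move=> e; apply: eq_bigr => i _; rewrite e. Qed.

Lemma fpow_nat (b : 'I_n.+1 -> nat) :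
  fpow (fun i => (b i)%:Z) = tofrac (\prod_i f i ^+ b i).
Proof. by rewrite rmorph_prod; apply: eq_bigr => i _; rewrite rmorphXn. Qed.

Lemma fprod_neq0 (b : 'I_n.+1 -> nat) : \prod_i f i ^+ b i != 0.
Proof. by apply/prodf_neq0 => i _; rewrite expf_neq0 // form_neq0. Qed.

Lemma fpow_frac c : fpow c =
  tofrac (\prod_i f i ^+ posi (c i)) / tofrac (\prod_i f i ^+ negi (c i)).
Proof.
rewrite !rmorph_prod -prodf_div; apply: eq_bigr => i _.
by rewrite exprz_posi_negi ?form_frac_neq0 // !rmorphXn.
Qed.

Lemma dhomog_fprod (b : 'I_n.+1 -> nat) :
  \prod_i f i ^+ b i \is (\sum_i b i * a i)%N.-homog.
Proof.
apply: (big_rec2 (fun (p : S) d => p \is d.-homog)); first exact: dhomog1.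
by move=> i d p _ hp; apply: dhomogM => //; rewrite mulnC; apply: dhomogMn.
Qed.

Lemma is_mult_fprod F (b d : 'I_n.+1 -> nat) : prime_elt F ->
  (forall j, is_mult F (f j) (d j)) ->
  is_mult F (\prod_i f i ^+ b i) (\sum_i b i * d i)%N.
Proof. by move=> pF h; apply: is_mult_prod => // i; apply: is_multX. Qed.

(** As the forms are pairwise non-associate, their multiplicities along F make up an indicator
    vector or vanish; the order of any product of forms is read off from this. *)
Lemma form_mult_cases F : prime_elt F ->
  (exists2 i, massoc F (f i) & forall j, is_mult F (f j) (j == i)) \/
  ((forall i, ~ massoc F (f i)) /\ forall j, is_mult F (f j) 0).
Proof.
move=> pF; have [[i ai]|no] := classic (exists i, massoc F (f i)); [left|right].
  exists i => // j; have [->|ne] := eqVneq j i; first exact: is_mult_assoc.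
  apply: is_mult_nassoc => // -[c [c0 ec]]; case: ai => d [d0 ed].
  apply: (f_na ne); exists (c^-1 * d); split; first by rewrite mulf_neq0 ?invr_eq0.
  by rewrite -scalerA -ed ec scalerA mulVf // scale1r.
have na i : ~ massoc F (f i) by move=> h; apply: no; exists i.
by split=> // j; apply: is_mult_nassoc.
Qed.

Lemma sum_indicator (b : 'I_n.+1 -> nat) i : (\sum_j b j * (j == i))%N = b i.
Proof.
rewrite (bigD1 i) //= eqxx muln1 big1 ?addn0 // => j /negPf->.
by rewrite muln0.
Qed.

Lemma degree_posi_negi (c : 'I_n.+1 -> int) : \sum_i c i * (a i)%:Z =
  (\sum_i posi (c i) * a i)%N%:Z - (\sum_i negi (c i) * a i)%N%:Z.
Proof.
rewrite !(big_morph Posz PoszD (erefl _)) -sumrB; apply: eq_bigr => i _.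
by rewrite {1}(posi_negi (c i)) mulrBl !PoszM.
Qed.

(** Along V(f_i) the order of this Laurent monomial is c_i, along any other prime it is 0; total
    degree zero places it in the function field. *)
Lemma H0_fpow (e c : 'I_n.+1 -> int) : (forall i, 0 <= c i + e i) ->
  \sum_i c i * (a i)%:Z = 0 -> H0 f e (fpow c).
Proof.
move=> ce; rewrite degree_posi_negi => /eqP; rewrite subr_eq0 => /eqP[edeg].
right; split; first exact: fpow_neq0.
have N0 := fprod_neq0 (fun i => posi (c i)); have D0 := fprod_neq0 (fun i => negi (c i)).
split.
  exists (\prod_i f i ^+ posi (c i)), (\prod_i f i ^+ negi (c i)), (\sum_i posi (c i) * a i)%N.
  split; first exact: dhomog_fprod.
  split; first by rewrite edeg; apply: dhomog_fprod.
  by split; last exact: fpow_frac.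
move=> F irrF _ z; have pF := mirreducible_prime irrF; rewrite fpow_frac => ordz.
have zE d : (forall j, is_mult F (f j) (d j)) ->
    z = (\sum_i posi (c i) * d i)%N%:Z - (\sum_i negi (c i) * d i)%N%:Z.
  by move=> hd; apply: (is_ord_uniq pF N0 D0 _ _ ordz); apply: is_mult_fprod.
have [[i ai hi]|[na h]] := form_mult_cases pF.
  have := zE _ hi; rewrite !sum_indicator -posi_negi => ->; split=> [j aj|/(_ i)//].
  suff <- : i = j by [].
  have [//|ne] := eqVneq i j; case: aj => x [x0 ex]; case: ai => y [y0 ey].
  case: (f_na ne); exists (y^-1 * x); split; first by rewrite mulf_neq0 ?invr_eq0.
  by rewrite -scalerA -ex ey scalerA mulVf // scale1r.
rewrite (zE _ h) !big1 ?subrr; try by move=> i _; rewrite muln0.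
by split=> // i /na.
Qed.

(** Multiplying g by the product of the f_i^(e_i) clears all poles, so the result [A / B] is a
    polynomial, homogeneous as a factor of [A]. *)
Lemma H0_numerator (e : 'I_n.+1 -> int) (g : K) : H0 f e g ->
  exists P : S, g = tofrac P * fpow (fun i => - e i) /\
    (P = 0 \/ exists2 d, P \is d.-homog & d%:Z = \sum_i e i * (a i)%:Z).
Proof.
case=> [->|[g0 [[p [q [d [hp [hq [q0 eg]]]]]] ordg]]].
  by exists 0; rewrite tofrac0 mul0r; split=> //; left.
have p0 : p != 0 by apply: contra_neq g0 => z; rewrite eg z tofrac0 mul0r.
pose A := p * \prod_i f i ^+ posi (e i); pose B := q * \prod_i f i ^+ negi (e i).
have A0 : A != 0 by rewrite mulf_neq0 // fprod_neq0.
have B0 : B != 0 by rewrite mulf_neq0 // fprod_neq0.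
have hA : A \is (d + \sum_i posi (e i) * a i)%N.-homog by rewrite dhomogM // dhomog_fprod.
have hB : B \is (d + \sum_i negi (e i) * a i)%N.-homog by rewrite dhomogM // dhomog_fprod.
have [P eP] : divides B A.
  apply: divides_by_mult => // F [|j] pF [c ec]; first by exists A; rewrite mul1r.
  (* [H0] tests only homogeneous primes; F is one because it divides the homogeneous [B]. *)
  have hF : mhomog F.
    apply: (@dhomog_factor _ _ F (F ^+ j * c) (d + \sum_i negi (e i) * a i)); rewrite mulrA -exprS -ec //.
  have irrF := prime_mirreducible pF.
  have [e1 h1] := is_mult_exists pF p0; have [e2 h2] := is_mult_exists pF q0.
  have [h3 h4] := ordg F irrF hF (e1%:Z - e2%:Z) ltac:(by exists p, q, e1, e2; do ![split=> //]).
  have done_ u v : is_mult F A u -> is_mult F B v -> (v <= u)%N -> divides (F ^+ j.+1) A.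
    move=> hu hv vu; have le : (j.+1 <= u)%N.
      by apply: leq_trans vu; apply: (is_mult_divides hv); exists c.
    have [F0 _ _] := pF; have [A' -> _] := (is_multP _ _ F0).1 hu.
    by exists (F ^+ (u - j.+1) * A'); rewrite mulrA -exprD subnKC.
  have [[i ai hi]|[na h]] := form_mult_cases pF.
    apply: (done_ _ _ (is_multM pF h1 (is_mult_fprod _ pF hi)) (is_multM pF h2 (is_mult_fprod _ pF hi))).
    rewrite !sum_indicator; have := h3 _ ai; have := posi_negi (e i); lia.
  apply: (done_ _ _ (is_multM pF h1 (is_mult_fprod _ pF h)) (is_multM pF h2 (is_mult_fprod _ pF h))).
  have := h4 na; rewrite !big1; try by move=> i _; rewrite muln0.
  lia.
exists P; split.
  have -> : fpow (fun i => - e i) = (fpow e)^-1.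
    apply: (mulIf (fpow_neq0 e)); rewrite mulVf ?fpow_neq0 // -fpowD.
    by rewrite /fpow big1 // => i _; rewrite addNr expr0z.
  rewrite fpow_frac eg; apply: divf_factor; rewrite ?tofrac_eq0 ?fprod_neq0 //.
  by rewrite -!tofracM -eP.
right; have [j hP] : exists j, P \is j.-homog.
  by apply: (@dhomog_factor _ _ P B (d + \sum_i posi (e i) * a i)); rewrite mulrC -eP.
exists j => //; rewrite degree_posi_negi.
have := dhomogM hB hP; rewrite -eP => /(dhomog_uniq A0 hA); lia.
Qed.

End Sections.

(** * The exponent cone *)

Section Cone.
Variables (n : nat) (a : 'I_n.+1 -> nat) (alpha : 'I_n.+1 -> rat).
Let degD : rat := \sum_(i < n.+1) alpha i * (a i)%:R.
Hypothesis a_gt0 : forall i, (0 < a i)%N.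
Hypothesis degD_gt0 : 0 < degD.

Notation expo := {ffun 'I_n.+1 -> int}.
Implicit Types (d : nat) (c : expo) (p : 'I_n.+1 -> nat).

Definition ell (i : 'I_n.+1) : nat :=
  \big[lcmn/1%N]_(j < n.+1 | j != i) `|denq (alpha j)|%N.

Definition total_degree : nat := (\sum_(i < n.+1) ell i * a i)%N.

Lemma ell_gt0 i : (0 < ell i)%N.
Proof.
apply: (big_ind (fun x => 0 < x)%N) => [//|x y x0 y0|j _]; first by rewrite lcmn_gt0 x0.
by rewrite absz_gt0 denq_neq0.
Qed.

Lemma ell_alpha_int i j : j != i -> (ell i)%:R * alpha j \is a Num.int.
Proof.
move=> ne; have /dvdnP[t ->] : (`|denq (alpha j)| %| ell i)%N.
  by rewrite /ell (bigD1 j) //= dvdn_lcml.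
have -> : (t * `|denq (alpha j)|)%:R * alpha j = t%:R * (numq (alpha j))%:~R.
  rewrite natrM -mulrA; congr (_ * _).
  rewrite -[in X in _ * X](divq_num_den (alpha j)) pmulrn gez0_abs ?denq_ge0 //.
  by rewrite mulrCA mulfV ?mulr1 // intr_eq0 denq_neq0.
by rewrite rpredM // ?natr_int ?intr_int.
Qed.

Definition cone_coord d c (i : 'I_n.+1) : rat := (c i)%:~R + d%:R * alpha i.

(** The number w is a degree defect: w = 0 describes the monomial sections of degree d, and w = a_i
    the multipliers that become sections after multiplication by something of degree a_i. *)
Definition in_cone (w : nat) d c :=
  \sum_i c i * (a i)%:Z = - w%:Z /\ forall i, 0 <= cone_coord d c i.

(* The lattice point (ell_i a_i, ray i) spans the i-th extremal ray: its i-th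
   coordinate is ell_i deg D and the others vanish. The floor is exact, see [rayE]. *)
Definition ray (i : 'I_n.+1) : expo :=
  [ffun j => Num.floor ((ell i)%:R * ((j == i)%:R * degD - (a i)%:R * alpha j))].

(** For j = i the term alpha_i a_i cancels against degD, leaving only alpha_l with l != i, whose
    denominators [ell i] clears. *)
Lemma rayE i j :
  (ray i j)%:~R = (ell i)%:R * ((j == i)%:R * degD - (a i)%:R * alpha j) :> rat.
Proof.
rewrite ffunE floorK //; have [->|ne] := eqVneq j i; last first.
  rewrite mul0r sub0r mulrN rpredN mulrCA rpredM ?natr_int //; exact: ell_alpha_int.
rewrite mul1r /degD (bigD1 i) //= [alpha i * _]mulrC addrAC subrr add0r mulr_sumr.
apply: rpred_sum => l ne; rewrite mulrA rpredM ?natr_int //; exact: ell_alpha_int.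
Qed.

(** Converts bounds on the coordinates into bounds on the degree d. *)
Lemma cone_coord_sum d c w : \sum_i c i * (a i)%:Z = - w%:Z ->
  \sum_i (a i)%:R * cone_coord d c i = d%:R * degD - w%:R.
Proof.
move=> e; rewrite addrC; have -> : - w%:R = (\sum_i c i * (a i)%:Z)%:~R :> rat.
  by rewrite e rmorphN.
rewrite rmorph_sum /= /degD mulr_sumr -big_split /=; apply: eq_bigr => i _.
by rewrite /cone_coord rmorphM /=; ring.
Qed.

Lemma degree_ray i : \sum_j ray i j * (a j)%:Z = 0.
Proof.
apply/eqP; rewrite -(intr_eq0 rat) rmorph_sum /=; apply/eqP.
transitivity (\sum_j ((ell i)%:R * ((j == i)%:R * degD * (a j)%:R)
                      - (ell i)%:R * (a i)%:R * (alpha j * (a j)%:R))).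
  by apply: eq_bigr => j _; rewrite rmorphM /= rayE -pmulrn; ring.
rewrite sumrB -!mulr_sumr -/degD (bigD1 i) //= eqxx big1 ?addr0.
  by rewrite mul1r -mulrA [degD * _]mulrC subrr.
by move=> j /negPf->; rewrite !mul0r.
Qed.

Definition shift_degree p : nat := (\sum_i p i * (ell i * a i))%N.
Definition shift_expo p : expo := \sum_i ray i *+ p i.

Lemma shift_expoE p j : shift_expo p j = \sum_i ray i j *+ p i.
Proof. by rewrite sum_ffunE; apply: eq_bigr => i _; rewrite ffunMnE. Qed.

Lemma shift_degreeD p p' : shift_degree (fun i => p i + p' i)%N = (shift_degree p + shift_degree p')%N.
Proof. by rewrite -big_split; apply: eq_bigr => i _; rewrite mulnDl. Qed.

Lemma shift_expoD p p' : shift_expo (fun i => p i + p' i)%N = shift_expo p + shift_expo p'.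
Proof. by rewrite -big_split; apply: eq_bigr => i _; rewrite mulrnDr. Qed.

(** In every coordinate but the i-th, the exponent of ray i cancels the growth of the degree
    term. *)
Lemma cone_coord_shift d c p j :
  cone_coord (d + shift_degree p) (c + shift_expo p) j = cone_coord d c j + (p j)%:R * ((ell j)%:R * degD).
Proof.
rewrite /cone_coord ffunE shift_expoE rmorphD rmorph_sum natrD /shift_degree natr_sum /=.
rewrite mulrDl addrACA; congr (_ + _).
rewrite mulr_suml -big_split /= (bigD1 j) //= big1 ?addr0.
  by rewrite rmorphMn /= rayE eqxx mul1r -mulr_natl !natrM; ring.
by move=> i; rewrite eq_sym => /negPf ne; rewrite rmorphMn /= rayE ne mul0r -mulr_natl !natrM; ring.
Qed.

Lemma degree_shift_expo p : \sum_j shift_expo p j * (a j)%:Z = 0.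
Proof.
transitivity (\sum_j \sum_i (ray i j * (a j)%:Z) *+ p i).
  by apply: eq_bigr => j _; rewrite shift_expoE mulr_suml; apply: eq_bigr => i _; rewrite mulrnAl.
by rewrite exchange_big big1 //= => i _; rewrite sumrMnl degree_ray mul0rn.
Qed.

(** How many times ray i fits into the i-th coordinate; on the cone the floor is nonnegative, so the
    absolute value changes nothing. *)
Definition ray_quo d c (i : 'I_n.+1) : nat := `|Num.floor (cone_coord d c i / ((ell i)%:R * degD))|%N.
(** The truncated subtraction is exact on cone points, by [cone_coord_rem]. *)
Definition rem_degree d c : nat := (d - shift_degree (ray_quo d c))%N.
Definition rem_expo d c : expo := c - shift_expo (ray_quo d c).

Let unit_gt0 i : 0 < (ell i)%:R * degD.
Proof. by rewrite mulr_gt0 // ltr0n ell_gt0. Qed.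

Lemma ray_quo_shift d c p i : 0 <= cone_coord d c i ->
  ray_quo (d + shift_degree p) (c + shift_expo p) i = (ray_quo d c i + p i)%N.
Proof.
move=> x0; rewrite /ray_quo cone_coord_shift mulrDl mulfK ?gt_eqF //.
rewrite floorDrz ?natr_int // -[(p i)%:R]/((p i)%:~R) intrKfloor.
have : 0 <= Num.floor (cone_coord d c i / ((ell i)%:R * degD)).
  by rewrite floor_ge0 divr_ge0 // ltW.
by case: (Num.floor _).
Qed.

Lemma eq_shift_degree p p' : p =1 p' -> shift_degree p = shift_degree p'.
Proof. by move=> e; apply: eq_bigr => i _; rewrite e. Qed.
Lemma eq_shift_expo p p' : p =1 p' -> shift_expo p = shift_expo p'.
Proof. by move=> e; apply: eq_bigr => i _; rewrite e. Qed.

(** Remainders are constant along the rays, which makes [lift] exactly compatible with ray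
    shifts. *)
Lemma rem_shift d c p : (forall i, 0 <= cone_coord d c i) ->
  rem_degree (d + shift_degree p) (c + shift_expo p) = rem_degree d c /\
  rem_expo (d + shift_degree p) (c + shift_expo p) = rem_expo d c.
Proof.
move=> x0; have e i := ray_quo_shift p (x0 i); rewrite /rem_degree /rem_expo; split.
  by rewrite (eq_shift_degree e) shift_degreeD subnDr.
by rewrite (eq_shift_expo e) shift_expoD [X in _ - X]addrC addrKA.
Qed.

Lemma cone_coord_rem w d c : in_cone w d c ->
  (shift_degree (ray_quo d c) <= d)%N /\
  forall i, 0 <= cone_coord (rem_degree d c) (rem_expo d c) i < (ell i)%:R * degD.
Proof.
case=> wc x0.
have r0 i : 0 <= cone_coord d c i - (ray_quo d c i)%:R * ((ell i)%:R * degD) < (ell i)%:R * degD.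
  have y0 : 0 <= cone_coord d c i / ((ell i)%:R * degD) by rewrite divr_ge0 // ltW.
  have -> : (ray_quo d c i)%:R = (Num.floor (cone_coord d c i / ((ell i)%:R * degD)))%:~R :> rat.
    by rewrite /ray_quo pmulrn gez0_abs // floor_ge0.
  have [] := (floor_le (cone_coord d c i / ((ell i)%:R * degD)), floorD1_gt (cone_coord d c i / ((ell i)%:R * degD))).
  rewrite intrD mulr1z ltr_pdivrMr // ler_pdivlMr // [(_ + 1) * _]mulrDl mul1r => h1 h2.
  by rewrite subr_ge0 h1 ltrBlDl.
(* Times degD, the difference of the two degrees is the weighted sum of the remainder coordinates
   plus w, all of them nonnegative. *)
have le : (shift_degree (ray_quo d c) <= d)%N.
  rewrite -(ler_nat rat) -(ler_pM2r degD_gt0) -subr_ge0.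
  have -> : d%:R * degD - (shift_degree (ray_quo d c))%:R * degD =
    \sum_i (a i)%:R * (cone_coord d c i - (ray_quo d c i)%:R * ((ell i)%:R * degD)) + w%:R.
    under [in RHS]eq_bigr do rewrite mulrBr.
    rewrite sumrB (cone_coord_sum d wc) /shift_degree natr_sum mulr_suml.
    rewrite addrAC subrK; congr (_ - _); apply: eq_bigr => i _; rewrite !natrM; ring.
  rewrite addr_ge0 // sumr_ge0 // => i _; rewrite mulr_ge0 //.
  by case/andP: (r0 i).
split=> // i; have := cone_coord_shift (rem_degree d c) (rem_expo d c) (ray_quo d c) i.
by rewrite subnK // subrK => e; have := r0 i; rewrite e addrK.
Qed.

Lemma rem_in_cone w d c : in_cone w d c -> in_cone w (rem_degree d c) (rem_expo d c).
Proof.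
move=> h; have [_ r0] := cone_coord_rem h; split=> [|i]; last by case/andP: (r0 i).
have [wc _] := h.
transitivity (\sum_i c i * (a i)%:Z - \sum_i shift_expo (ray_quo d c) i * (a i)%:Z).
  by rewrite -sumrB; apply: eq_bigr => i _; rewrite !ffunE mulrBl.
by rewrite degree_shift_expo subr0.
Qed.

(** By [cone_coord_sum], the remainder degree times degD is w plus the sum of the a_i times the
    coordinates, each of which is below ell_i degD. *)
Lemma rem_bound w d c : in_cone w d c ->
  (rem_degree d c)%:R < w%:R / degD + total_degree%:R.
Proof.
move=> h; have [wr _] := rem_in_cone h; have [_ r0] := cone_coord_rem h.
rewrite -(ltr_pM2r degD_gt0) mulrDl divfK ?gt_eqF //.
rewrite addrC -ltrBlDr -(cone_coord_sum _ wr) /total_degree natr_sum mulr_suml.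
(* Strictness of the sum needs a nonempty index set, witnessed by [ord0]. *)
apply: ltr_sum => [|i _]; first by apply/hasP; exists ord0; rewrite ?mem_index_enum.
rewrite natrM mulrAC -mulrA [X in _ < X]mulrC.
by rewrite [X in _ < X](_ : _ = (a i)%:R * ((ell i)%:R * degD)); [rewrite ltr_pM2l ?ltr0n //; case/andP: (r0 i)|ring].
Qed.

Lemma ray_in_cone i : in_cone 0 (ell i * a i) (ray i).
Proof.
split=> [|j]; first by rewrite degree_ray oppr0.
rewrite /cone_coord rayE natrM mulrBr -[X in _ + X]mulrA subrK mulrCA.
by rewrite mulr_ge0 ?ler0n // ltW.
Qed.

Lemma in_coneD w w' d d' c c' : in_cone w d c -> in_cone w' d' c' ->
  in_cone (w + w') (d + d') (c + c').
Proof.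
move=> [wc x0] [wc' x0']; split=> [|i].
  under eq_bigr do rewrite ffunE mulrDl.
  by rewrite big_split /= wc wc' PoszD opprD.
have -> : cone_coord (d + d') (c + c') i = cone_coord d c i + cone_coord d' c' i.
  by rewrite /cone_coord ffunE rmorphD natrD /=; ring.
by rewrite addr_ge0.
Qed.

End Cone.

(** * Monomials in the section ring *)

Section ConstantEmbedding.
Variables (k : closedFieldType) (m : nat).

Lemma kconst_is_zmod : zmod_morphism (@kconst k m).
Proof. by move=> x y; rewrite /kconst mpolyCB tofracB polyCB. Qed.

Lemma kconst_is_monoid : monoid_morphism (@kconst k m).
Proof.
split; first by rewrite /kconst mpolyC1 tofrac1.
by move=> x y; rewrite /kconst mpolyCM tofracM polyCM.
Qed.

HB.instance Definition _ := GRing.isZmodMorphism.Build k {poly Kfield k m} (@kconst k m) kconst_is_zmod.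
HB.instance Definition _ := GRing.isMonoidMorphism.Build k {poly Kfield k m} (@kconst k m) kconst_is_monoid.

Lemma eq_in_kalg (S T : {poly Kfield k m} -> Prop) x :
  (forall y, S y -> in_kalg T y) -> in_kalg S x -> in_kalg T x.
Proof.
move=> st; elim=> [c|y /st//|y z _ hy _ hz|y z _ hy _ hz].
- exact: alg_const.
- exact: alg_add.
- exact: alg_mul.
Qed.

Lemma in_kalg_sum (I : eqType) (r : seq I) (F : I -> {poly Kfield k m}) (S : {poly Kfield k m} -> Prop) :
  (forall i, i \in r -> in_kalg S (F i)) -> in_kalg S (\sum_(i <- r) F i).
Proof.
elim: r => [|i r IH] h; first by rewrite big_nil -(rmorph0 (@kconst k m)); apply: alg_const.
rewrite big_cons; apply: alg_add; first by apply: h; rewrite mem_head.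
by apply: IH => j jr; apply: h; rewrite inE jr orbT.
Qed.

Lemma in_kalg_prod (I : Type) (r : seq I) (F : I -> {poly Kfield k m}) (S : {poly Kfield k m} -> Prop) :
  (forall i, in_kalg S (F i)) -> in_kalg S (\prod_(i <- r) F i).
Proof.
move=> h; elim: r => [|i r IH].
  by rewrite big_nil -(rmorph1 (@kconst k m)); apply: alg_const.
by rewrite big_cons; apply: alg_mul.
Qed.

Lemma in_kalg_exp (x : {poly Kfield k m}) j (S : {poly Kfield k m} -> Prop) : in_kalg S x -> in_kalg S (x ^+ j).
Proof.
move=> h; elim: j => [|j IH]; last by rewrite exprS; apply: alg_mul.
by rewrite expr0 -(rmorph1 (@kconst k m)); apply: alg_const.
Qed.

End ConstantEmbedding.

Section SectionRing.
Variables (k : closedFieldType) (m n : nat).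
Notation S := {mpoly k[m.+1]}.
Notation Y := {mpoly k[n.+1]}.
Notation K := (Kfield k m).
Notation expo := {ffun 'I_n.+1 -> int}.
Variables (f : 'I_n.+1 -> S) (a : 'I_n.+1 -> nat) (alpha : 'I_n.+1 -> rat).
Hypothesis f_irr : forall i, mirreducible (f i).
Hypothesis f_hom : forall i, f i \is (a i).-homog.
Hypothesis f_na : forall i j, i != j -> ~ massoc (f i) (f j).
Hypothesis degD_gt0 : 0 < \sum_(i < n.+1) alpha i * (a i)%:R.
Variable s : 'I_m.+1 -> 'I_n.+1.
Hypothesis s_hom : forall j, f (s j) \is 1%N.-homog.
Hypothesis s_free :
  forall c : 'I_m.+1 -> k, \sum_(j < m.+1) c j *: f (s j) = 0 -> forall j, c j = 0.

Lemma form_degree_gt0 i : (0 < a i)%N.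
Proof.
have := f_hom i; case: (a i) => // /dhomogP h; have [sf _] := f_irr i.
suff : (msize (f i) <= 1)%N by rewrite leqNgt sf.
by rewrite msizeE; apply/bigmax_leqP_seq => b bf _; rewrite h.
Qed.

Lemma linear_form_degree j : a (s j) = 1%N.
Proof. by apply: (dhomog_uniq (form_neq0 f_irr (s j))). Qed.

Definition eval_forms : Y -> S := mmap (@mpolyC m.+1 k) f.
HB.instance Definition _ := GRing.RMorphism.on eval_forms.

Lemma linear_formE (p : S) : p \is 1.-homog -> p = \sum_l p@_U_(l) *: 'X_l.
Proof.
move=> hp; apply/mpolyP => b; rewrite raddf_sum /=.
under eq_bigr do rewrite mcoeffZ mcoeffX.
have [|nb] := boolP (mdeg b == 1%N).
  case/mdeg1P => i /eqP ->; rewrite (bigD1 i) //= eqxx mulr1 big1 ?addr0 // => j ne.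
  by rewrite eq_mnm1 (negPf ne) mulr0.
rewrite (dhomog_nemf_coeff hp nb) big1 // => i _.
by case: (U_(i)%MM =P b) nb => [<-|_ _]; rewrite ?mdeg1 ?mulr0.
Qed.

(** Linear independence makes the square coefficient matrix of the m + 1 linear forms invertible. *)
Lemma variable_from_forms : exists B : 'M[k]_m.+1,
  forall l, 'X_l = \sum_j B l j *: f (s j).
Proof.
pose C : 'M[k]_m.+1 := \matrix_(j, l) (f (s j))@_U_(l).
have fC j : f (s j) = \sum_l C j l *: 'X_l.
  by rewrite [LHS](linear_formE (s_hom j)); apply: eq_bigr => l _; rewrite mxE.
have comb (A : 'M_m.+1) i : \sum_j A i j *: f (s j) = \sum_l (A *m C) i l *: 'X_l.
  under eq_bigr do rewrite fC scaler_sumr; rewrite exchange_big /=.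
  apply: eq_bigr => l _; rewrite mxE scaler_suml.
  by apply: eq_bigr => j _; rewrite scalerA.
have uC : C \in unitmx.
  rewrite -row_free_unit -kermx_eq0; apply/eqP/row_matrixP => i.
  rewrite row0; apply/rowP => j; rewrite mxE [RHS]mxE.
  apply: (s_free (c := fun j => kermx C i j)).
  by rewrite comb mulmx_ker big1 // => l _; rewrite mxE scale0r.
exists (invmx C) => l; rewrite comb mulVmx // (bigD1 l) //= mxE eqxx scale1r.
by rewrite big1 ?addr0 // => i ne; rewrite mxE eq_sym (negPf ne) scale0r.
Qed.

(* As the linear forms among the f_i generate k[x], evaluation at the forms has
   a graded section. *)
Lemma eval_forms_section : exists phi : {rmorphism S -> Y},
  [/\ forall c, phi c%:MP = c%:MP, forall p, eval_forms (phi p) = p &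
      forall d p, p \is d.-homog -> phi p \is d.-homog for (wt a)].
Proof.
have [B eB] := variable_from_forms.
pose h l : Y := \sum_j B l j *: 'X_(s j).
exists (mmap (@mpolyC n.+1 k) h); split=> [c|p|d p /dhomogP hp]; first exact: mmapC.
  elim/mpolyind: p => [|c b p _ _ IH]; first by rewrite !rmorph0.
  rewrite !rmorphD /= IH; congr (_ + _); rewrite -mul_mpolyC !rmorphM /=.
  rewrite /eval_forms !mmapC mmapX; congr (_ * _).
  rewrite /mmap1 rmorph_prod mpolyXE_id; apply: eq_bigr => l _.
  rewrite rmorphXn; congr (_ ^+ _); rewrite eB /h rmorph_sum; apply: eq_bigr => j _.
  by rewrite /= mmapZ mmapX mmap1U mul_mpolyC.
rewrite /= /mmap big_seq; apply: rpred_sum => b bp; rewrite mul_mpolyC rpredZ //.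
have <- : (\sum_i b i)%N = d by rewrite -mdegE; exact: hp bp.
rewrite /mmap1.
apply: (big_rec2 (fun (p : Y) d => p \is d.-homog for (wt a))); first exact: dhomog1.
move=> i e q _ hq; apply: dhomogM => //.
have h1 : h i \is 1.-homog for (wt a).
  apply: rpred_sum => j _; rewrite rpredZ // dhomogX /=.
  by rewrite wt1 linear_form_degree.
by have := dhomogMn (b i) h1; rewrite mul1n.
Qed.

Definition floorD (d : nat) (i : 'I_n.+1) : int := Num.floor (d%:R * alpha i).

(** Passes from the exponents b of a numerator to those of the section obtained by dividing by the
    product of the f_i^(floor (d alpha_i)). *)
Definition expo_of d (b : 'X_{1..n.+1}) : expo := [ffun i => (b i)%:Z - floorD d i].

Definition mono d (c : expo) : {poly K} := (fpow f c)%:P * 'X^d.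

Definition eval_section d (p : Y) : {poly K} :=
  (tofrac (eval_forms p) * fpow f (fun i => - floorD d i))%:P * 'X^d.

Lemma eval_section_is_zmod d : zmod_morphism (eval_section d).
Proof. by move=> p q; rewrite /eval_section rmorphB rmorphB mulrBl polyCB mulrBl. Qed.

HB.instance Definition _ d :=
  GRing.isZmodMorphism.Build Y {poly K} (eval_section d) (eval_section_is_zmod d).

Lemma eval_sectionZ d c p : eval_section d (c *: p) = kconst m c * eval_section d p.
Proof.
rewrite /eval_section /eval_forms mmapZ tofracM /kconst -!mulrA polyCM -mulrA.
by rewrite polyCM.
Qed.

Lemma eval_sectionX d b : eval_section d 'X_[b] = mono d (expo_of d b).
Proof.
have e : tofrac (eval_forms 'X_[b]) = fpow f (fun i => (b i)%:Z).
  by rewrite fpow_nat /eval_forms mmapX.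
have e' : fpow f (expo_of d b) =
    fpow f (fun i => (b i)%:Z) * fpow f (fun i => - floorD d i).
  by rewrite -(fpowD f_irr); apply: eq_fpow => i; rewrite ffunE.
by rewrite /eval_section /mono e e'.
Qed.

Lemma eval_section_sum d p :
  eval_section d p = \sum_(b <- msupp p) kconst m p@_b * mono d (expo_of d b).
Proof.
rewrite {1}(mpolyE p) raddf_sum /=; apply: eq_bigr => b _.
by rewrite eval_sectionZ eval_sectionX.
Qed.

Lemma expo_of_in_cone d b w : (wt a b)%:Z + w%:Z = \sum_i floorD d i * (a i)%:Z ->
  in_cone a alpha w d (expo_of d b).
Proof.
move=> e; split=> [|i]; last first.
  rewrite /cone_coord ffunE intrD rmorphN /= -addrA addr_ge0 ?ler0n // addrC subr_ge0.
  exact: floor_le.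
under eq_bigr do rewrite ffunE mulrBl; rewrite sumrB -e.
by rewrite /wt (big_morph Posz PoszD (erefl _)) opprD addrA subrr add0r.
Qed.

Lemma in_cone_floor w d c i : in_cone a alpha w d c -> 0 <= c i + floorD d i.
Proof.
case=> _ /(_ i); rewrite /cone_coord -lerBlDl sub0r => h.
by rewrite addrC -lerBlDr sub0r /floorD floor_ge_int rmorphN.
Qed.

(** Converse to [expo_of_in_cone]: since c_i is an integer, d alpha_i may be replaced by its floor,
    and adding the floors to c gives natural exponents. *)
Lemma in_coneP w d c : in_cone a alpha w d c ->
  exists2 b, c = expo_of d b & (wt a b)%:Z + w%:Z = \sum_i floorD d i * (a i)%:Z.
Proof.
move=> h; have h0 i := in_cone_floor i h; exists [multinom absz (c i + floorD d i)%R | i < n.+1].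
  by apply/ffunP => i; rewrite ffunE mnmE gez0_abs // addrK.
have [wc _] := h; rewrite -[w%:Z]opprK -wc /wt (big_morph Posz PoszD (erefl _)) -sumrB.
by apply: eq_bigr => i _; rewrite mnmE PoszM gez0_abs // mulrDl addrAC subrr add0r.
Qed.

Lemma mono_in_RD d c : in_cone a alpha 0 d c -> in_RD f alpha (mono d c).
Proof.
move=> h d'; rewrite coefCM coefXn; case: eqP => [->|_]; last by left; rewrite mulr0.
rewrite mulr1; apply: (H0_fpow f_irr f_hom f_na) => [i|].
  exact: in_cone_floor h.
by case: h.
Qed.

Lemma homog_mono d c : homog_deg (mono d c) d.
Proof. by exists (fpow f c). Qed.

(** The numerator from [H0_numerator] is a polynomial in the x_j; the graded section of [eval_forms]
    rewrites it in the forms without changing its weight. *)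
Lemma RD_component P d : in_RD f alpha P -> exists2 p : Y,
  (P`_d)%:P * 'X^d = eval_section d p &
  forall b, b \in msupp p -> (wt a b)%:Z = \sum_i floorD d i * (a i)%:Z.
Proof.
move=> /(_ d) /(H0_numerator f_irr f_hom f_na)[q [-> hq]].
have [phi [_ phiK phiH]] := eval_forms_section.
exists (phi q); first by rewrite /eval_section phiK.
case: hq => [->|[e he <-]] b; first by rewrite rmorph0 msupp0.
by move: (phiH _ _ he) => /dhomogP /[apply] ->.
Qed.

Lemma monoD d d' c c' : mono (d + d') (c + c') = mono d c * mono d' c'.
Proof.
have e : fpow f (c + c') = fpow f c * fpow f c'.
  by rewrite -(fpowD f_irr); apply: eq_fpow => i; rewrite ffunE.
by rewrite /mono e polyCM exprD mulrACA.
Qed.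

Lemma mono0 : mono 0 0 = 1.
Proof. by rewrite /mono /fpow big1 ?mulr1 // => i _; rewrite ffunE expr0z. Qed.

Lemma mono_shift p : mono (shift_degree a alpha p) (shift_expo a alpha p) =
  \prod_i mono (ell alpha i * a i) (ray a alpha i) ^+ p i.
Proof.
have monoMn d c j : mono (j * d) (c *+ j) = mono d c ^+ j.
  by elim: j => [|j IH]; rewrite ?mulSn ?mulrS ?exprS ?monoD ?IH ?mono0.
rewrite /shift_degree /shift_expo.
elim: (index_enum _) => [|i r IH]; first by rewrite !big_nil mono0.
by rewrite !big_cons monoD IH monoMn.
Qed.

Lemma mono_rem d c : in_cone a alpha 0 d c -> mono d c =
  (\prod_i mono (ell alpha i * a i) (ray a alpha i) ^+ ray_quo a alpha d c i) *
  mono (rem_degree a alpha d c) (rem_expo a alpha d c).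
Proof.
move=> h; have [le _] := cone_coord_rem degD_gt0 h.
have hd : (shift_degree a alpha (ray_quo a alpha d c) + rem_degree a alpha d c)%N = d.
  exact: subnKC.
have hc : shift_expo a alpha (ray_quo a alpha d c) + rem_expo a alpha d c = c.
  exact: subrKC.
transitivity (mono (shift_degree a alpha (ray_quo a alpha d c) + rem_degree a alpha d c)
                   (shift_expo a alpha (ray_quo a alpha d c) + rem_expo a alpha d c)).
  by rewrite hd hc.
by rewrite monoD (mono_shift (ray_quo a alpha d c)).
Qed.

Lemma rem_degree_le d c : in_cone a alpha 0 d c ->
  (rem_degree a alpha d c <= total_degree a alpha)%N.
Proof.
move=> h; have := rem_bound form_degree_gt0 degD_gt0 h.
by rewrite mul0r add0r ltr_nat => /ltnW.
Qed.

Lemma ray_degree_le i : (ell alpha i * a i <= total_degree a alpha)%N.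
Proof. by rewrite /total_degree (bigD1 i) //= leq_addr. Qed.

Lemma RD_generated P : in_RD f alpha P ->
  in_kalg (fun x => in_RD f alpha x /\ exists d, (d <= total_degree a alpha)%N /\ homog_deg x d) P.
Proof.
move=> hP; rewrite -[P]coefK poly_def; apply: in_kalg_sum => d _.
rewrite -mul_polyC; have [p -> hp] := RD_component d hP; rewrite eval_section_sum.
apply: in_kalg_sum => b bp; apply: alg_mul; first exact: alg_const.
have hc : in_cone a alpha 0 d (expo_of d b) by apply: expo_of_in_cone; rewrite addr0 hp.
rewrite (mono_rem hc); apply: alg_mul.
  apply: in_kalg_prod => i; apply: in_kalg_exp; apply: alg_gen.
  split; first by apply/mono_in_RD/ray_in_cone.
  by exists (ell alpha i * a i)%N; split; [exact: ray_degree_le|exact: homog_mono].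
apply: alg_gen; split.
  by apply/mono_in_RD/rem_in_cone.
by exists (rem_degree a alpha d (expo_of d b)); split; [exact: rem_degree_le|exact: homog_mono].
Qed.

End SectionRing.

(** * Relations *)

Section LinearExtension.
Variables (n : nat) (R : nzRingType) (V : lmodType R) (F : 'X_{1..n} -> V).

Definition lin_ext (p : {mpoly R[n]}) : V := \sum_(b <- msupp p) p@_b *: F b.

(** Supports vary with the polynomial; summing over all monomials of bounded degree gives a common
    index set, from which linearity follows. *)
Lemma lin_extE i p : (msize p <= i)%N ->
  lin_ext p = \sum_(b : 'X_{1..n < i}) p@_b *: F b.
Proof.
move=> le_pi; set I : subFinType _ := 'X_{1..n < i}.
rewrite /lin_ext (big_mksub I) ?msupp_uniq //=; last first.
  by move=> x /msize_mdeg_lt /leq_trans; apply.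
by rewrite big_rmcond //= => j /memN_msupp_eq0 ->; rewrite scale0r.
Qed.

Lemma lin_ext_is_linear : linear lin_ext.
Proof.
move=> c p q; pose i := maxn (msize (c *: p + q)) (maxn (msize p) (msize q)).
have hp : (msize p <= i)%N by rewrite /i !leq_max leqnn orbT.
have hq : (msize q <= i)%N by rewrite /i !leq_max leqnn !orbT.
have hpq : (msize (c *: p + q) <= i)%N by rewrite /i leq_max leqnn.
rewrite (lin_extE hp) (lin_extE hq) (lin_extE hpq) scaler_sumr -big_split /=.
by apply: eq_bigr => b _; rewrite mcoeffD mcoeffZ scalerDl scalerA.
Qed.

HB.instance Definition _ :=
  GRing.isLinear.Build R {mpoly R[n]} V _ lin_ext lin_ext_is_linear.

Lemma lin_extX b : lin_ext 'X_[b] = F b.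
Proof. by rewrite /lin_ext msuppX big_seq1 mcoeffX eqxx scale1r. Qed.

End LinearExtension.

Section Relations.
Variables (k : closedFieldType) (m n : nat).
Notation S := {mpoly k[m.+1]}.
Notation Y := {mpoly k[n.+1]}.
Notation K := (Kfield k m).
Notation expo := {ffun 'I_n.+1 -> int}.
Variables (f : 'I_n.+1 -> S) (a : 'I_n.+1 -> nat) (alpha : 'I_n.+1 -> rat).
Hypothesis f_irr : forall i, mirreducible (f i).
Hypothesis f_hom : forall i, f i \is (a i).-homog.
Hypothesis f_na : forall i j, i != j -> ~ massoc (f i) (f j).
Notation degD := (\sum_(i < n.+1) alpha i * (a i)%:R).
Hypothesis degD_gt0 : 0 < degD.
Variable s : 'I_m.+1 -> 'I_n.+1.
Hypothesis s_hom : forall j, f (s j) \is 1%N.-homog.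
Hypothesis s_free :
  forall c : 'I_m.+1 -> k, \sum_(j < m.+1) c j *: f (s j) = 0 -> forall j, c j = 0.

Notation L := (total_degree a alpha).
Notation in_cone := (in_cone a alpha).
Notation mono := (mono f).
Notation ray_quo := (ray_quo a alpha).
Notation rem_degree := (rem_degree a alpha).
Notation rem_expo := (rem_expo a alpha).
Notation shift_degree := (shift_degree a alpha).
Notation shift_expo := (shift_expo a alpha).
Notation eval_section := (eval_section f alpha).

Variables (r : nat) (g : 'I_r -> {poly K}) (dg : 'I_r -> nat).
Notation W := {mpoly k[r]}.
Hypothesis g_hom : forall j, in_RD f alpha (g j) /\ g j != 0 /\ homog_deg (g j) (dg j).
Hypothesis g_gen : forall P, in_RD f alpha P -> in_kalg (fun x => exists j, x = g j) P.
Hypothesis g_min : forall j0, ~ (forall P, in_RD f alpha P ->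
                     in_kalg (fun x => exists j, j != j0 /\ x = g j) P).

Definition ev : W -> {poly K} := mmap (@kconst k m) g.
HB.instance Definition _ := GRing.RMorphism.on ev.

Lemma evX_homog b : exists C : K, ev 'X_[b] = C%:P * 'X^(wt dg b).
Proof.
rewrite /ev mmapX /mmap1 /wt.
apply: (big_rec2 (fun (x : {poly K}) d => exists C : K, x = C%:P * 'X^d)).
  by exists 1; rewrite mul1r.
move=> j d x _ [C ->]; have [_ [_ [c ->]]] := g_hom j.
by exists (c ^+ b j * C); rewrite exprMn -exprM mulnC exprD polyCM polyC_exp mulrACA.
Qed.

Lemma evZ c Q : ev (c *: Q) = kconst m c * ev Q.
Proof. exact: mmapZ. Qed.

(** Compatibility of [ev] with the gradings: it makes the kernel graded and lets preimages of
    homogeneous elements be chosen homogeneous. *)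
Lemma ev_pihomog d Q : ev (pihomog (wt dg) d Q) = ((ev Q)`_d)%:P * 'X^d.
Proof.
elim/mpolyind: Q => [|c b Q _ _ IH].
  by rewrite raddf0 !rmorph0 coef0 mul0r.
rewrite linearD linearZ /= !rmorphD /= IH coefD polyCD mulrDl; congr (_ + _).
rewrite pihomogX !evZ; have [C eC] := evX_homog b.
rewrite coefCM polyCM -mulrA; congr (_ * _).
case: eqP => [<-|ne]; first by rewrite eC coefCM coefXn eqxx mulr1.
have hne : (d == wt dg b) = false by apply/eqP => e; apply: ne; rewrite e.
by rewrite rmorph0 eC coefCM coefXn hne mulr0 polyC0 mul0r.
Qed.

Lemma ev_surj x : in_kalg (fun x => exists j, x = g j) x -> exists Q, ev Q = x.
Proof.
elim=> [c|_ [j ->]|_ _ _ [P <-] _ [Q <-]|_ _ _ [P <-] _ [Q <-]].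
- by exists c%:MP; rewrite /ev mmapC.
- by exists 'X_j; rewrite /ev mmapX mmap1U.
- by exists (P + Q); rewrite rmorphD.
- by exists (P * Q); rewrite rmorphM.
Qed.

Lemma RD_lift d x : in_RD f alpha x -> homog_deg x d ->
  exists2 Q, Q \is d.-homog for (wt dg) & ev Q = x.
Proof.
move=> hx [c ex]; have [Q eQ] := ev_surj (g_gen hx).
exists (pihomog (wt dg) d Q); first exact: pihomogP.
by rewrite ev_pihomog eQ ex coefCM coefXn eqxx mulr1.
Qed.

(** If [dg j0] exceeded L, the variable of index [j0] could not occur in a homogeneous preimage of
    an element of degree at most L. Such elements generate, so the other g_j would suffice, against
    minimality. *)
Lemma generator_degree_le j0 : (dg j0 <= L)%N.
Proof.
rewrite leqNgt; apply/negP => lt; apply: (@g_min j0) => P hP.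
have := RD_generated f_irr f_hom f_na degD_gt0 s_hom s_free hP.
apply: eq_in_kalg => y [hy [d [dL yd]]]; have [Q /dhomogP hQ <-] := RD_lift hy yd.
rewrite /ev /mmap; apply: in_kalg_sum => b bQ; apply: alg_mul; first exact: alg_const.
apply: in_kalg_prod => j; have [->|ne] := eqVneq j j0; last first.
  by apply: in_kalg_exp; apply: alg_gen; exists j.
suff -> : b j0 = 0%N by rewrite expr0 -(rmorph1 (@kconst k m)); apply: alg_const.
have le : (b j0 * dg j0 <= d)%N.
  by rewrite -(hQ _ bQ) /= /wt (bigD1 j0) //= leq_addr.
apply/eqP; rewrite -leqn0 leqNgt; apply/negP => b0.
by have := leq_trans (leq_pmull (dg j0) b0) (leq_trans le dL); rewrite leqNgt lt.
Qed.

Variable M : rat.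
Hypothesis M_2L : (2 * L)%N%:R <= M.
Hypothesis M_form : forall i, (a i)%:R / degD + L%:R <= M.

(** M enters only through two lower bounds: 2L accounts for products of two remainders, and a_i /
    degD + L for multiples of relations among the forms. *)
Definition in_ideal (Q : W) := exists (t : nat) (h q : 'I_t -> W),
  (forall i, ev (q i) = 0 /\ exists e, whomog dg (q i) e /\ e%:R <= M) /\
  Q = \sum_(i < t) h i * q i.

Lemma in_ideal_relation Q e : ev Q = 0 -> Q \is e.-homog for (wt dg) -> e%:R <= M ->
  in_ideal Q.
Proof.
move=> Q0 /dhomogP hQ eM; exists 1%N, (fun _ => 1), (fun _ => Q).
by split; [move=> _; split=> //; exists e|rewrite big_ord1 mul1r].
Qed.

Lemma in_ideal0 : in_ideal 0.
Proof. by exists 0%N, (fun _ => 0), (fun _ => 0); split=> [[]//|]; rewrite big_ord0. Qed.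

Lemma in_idealD P Q : in_ideal P -> in_ideal Q -> in_ideal (P + Q).
Proof.
move=> [t [h [q [hq ->]]]] [t' [h' [q' [hq' ->]]]]; exists (t + t')%N.
exists (fun i => match split i with inl j => h j | inr j => h' j end).
exists (fun i => match split i with inl j => q j | inr j => q' j end).
split=> [i|]; first by case: (split i).
rewrite big_split_ord /=; congr (_ + _); apply: eq_bigr => i _.
  by case: (splitP (lshift t' i)) => j /= e; [rewrite (val_inj e)|have := ltn_ord i; rewrite e ltnNge leq_addr].
case: (splitP (rshift t i)) => j /= e; first by have := ltn_ord j; rewrite -e ltnNge leq_addr.
by have /val_inj-> := addnI e.
Qed.

Lemma in_idealM P Q : in_ideal Q -> in_ideal (P * Q).
Proof.
move=> [t [h [q [hq ->]]]]; exists t, (fun i => P * h i), q; split=> //.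
by rewrite mulr_sumr; apply: eq_bigr => i _; rewrite mulrA.
Qed.

Lemma in_idealZ c Q : in_ideal Q -> in_ideal (c *: Q).
Proof. by rewrite -mul_mpolyC; apply: in_idealM. Qed.

Lemma in_ideal_sum (I : eqType) (l : seq I) (F : I -> W) :
  (forall i, i \in l -> in_ideal (F i)) -> in_ideal (\sum_(i <- l) F i).
Proof.
elim: l => [|i l IH] h; first by rewrite big_nil; apply: in_ideal0.
rewrite big_cons; apply: in_idealD; first by apply: h; rewrite mem_head.
by apply: IH => j jl; apply: h; rewrite inE jl orbT.
Qed.

Lemma in_ideal_ev Q : in_ideal Q -> ev Q = 0.
Proof.
move=> [t [h [q [hq ->]]]]; rewrite rmorph_sum big1 // => i _.
by rewrite rmorphM /= (hq i).1 mulr0.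
Qed.

(** A fixed homogeneous preimage for each exponent, meaningful on cone points of defect 0; elsewhere
    the choice is arbitrary. *)
Definition mono_lift d (c : expo) : W :=
  epsilon (inhabits 0) (fun Q => Q \is d.-homog for (wt dg) /\ ev Q = mono d c).

Lemma mono_liftP d c : in_cone 0 d c ->
  mono_lift d c \is d.-homog for (wt dg) /\ ev (mono_lift d c) = mono d c.
Proof.
move=> h.
apply: (epsilon_spec (inhabits 0) (fun Q => Q \is d.-homog for (wt dg) /\ ev Q = mono d c)).
have [Q hQ eQ] := RD_lift (mono_in_RD f_irr f_hom f_na h) (homog_mono f d c).
by exists Q.
Qed.

Definition ray_lift i : W := mono_lift (ell alpha i * a i) (ray a alpha i).
Definition ray_lifts (p : 'I_n.+1 -> nat) : W := \prod_i ray_lift i ^+ p i.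

(* A multiplicative-up-to-relations choice of lifts: the rays are lifted once,
   and only the finitely many remainders modulo the rays need separate lifts. *)
Definition lift d (c : expo) : W :=
  ray_lifts (ray_quo d c) * mono_lift (rem_degree d c) (rem_expo d c).

Lemma ray_liftsD p p' :
  ray_lifts (fun i => p i + p' i)%N = ray_lifts p * ray_lifts p'.
Proof. by rewrite -big_split; apply: eq_bigr => i _; rewrite exprD. Qed.

Lemma lift_homog d c : in_cone 0 d c -> lift d c \is d.-homog for (wt dg).
Proof.
move=> h; have [le _] := cone_coord_rem degD_gt0 h.
have e : (shift_degree (ray_quo d c) + rem_degree d c)%N = d by exact: subnKC.
rewrite -[X in X.-homog for _]e /lift; apply: dhomogM; last first.
  by have [] := mono_liftP (rem_in_cone degD_gt0 h).
apply: (big_rec2 (fun (p : W) d => p \is d.-homog for (wt dg))); first exact: dhomog1.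
move=> i e' p _ hp; apply: dhomogM => //; rewrite mulnC; apply: dhomogMn.
by have [] := mono_liftP (ray_in_cone degD_gt0 i).
Qed.

Lemma ev_lift d c : in_cone 0 d c -> ev (lift d c) = mono d c.
Proof.
move=> h; rewrite (mono_rem f_irr degD_gt0 h) rmorphM rmorph_prod /=.
have [_ ->] := mono_liftP (rem_in_cone degD_gt0 h); congr (_ * _).
apply: eq_bigr => i _; rewrite rmorphXn /=.
by have [_ ->] := mono_liftP (ray_in_cone degD_gt0 i).
Qed.

(** An equality rather than a congruence: the remainder, hence its chosen lift, is unchanged, and
    only the ray powers grow. *)
Lemma lift_shift d c p : (forall i, 0 <= cone_coord alpha d c i) ->
  lift (d + shift_degree p) (c + shift_expo p) = ray_lifts p * lift d c.
Proof.
move=> h; have [e1 e2] := rem_shift degD_gt0 p h.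
rewrite /lift e1 e2 mulrA -ray_liftsD; congr (_ * _).
by apply: eq_bigr => i _; rewrite (ray_quo_shift degD_gt0 p (h i)) addnC.
Qed.

(** The rays are split off according to c alone, so the same ray factor serves for every t. This
    allows a whole relation with varying t to be divided by it. *)
Lemma lift_rem w d c (t : expo) : in_cone w d c -> (forall i, 0 <= t i) ->
  lift d (c + t) = ray_lifts (ray_quo d c) * lift (rem_degree d c) (rem_expo d c + t).
Proof.
move=> h t0; have [le _] := cone_coord_rem degD_gt0 h.
have [_ r0] := rem_in_cone degD_gt0 h; rewrite -lift_shift.
  by rewrite subnK // addrAC subrK.
move=> i; have -> : cone_coord alpha (rem_degree d c) (rem_expo d c + t) i =
  cone_coord alpha (rem_degree d c) (rem_expo d c) i + (t i)%:~R.
  by rewrite /cone_coord [(_ + t) i]ffunE intrD addrAC.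
by rewrite addr_ge0 // ler0z.
Qed.

(** Both terms contain the ray factor [ray_lifts p]. What is left compares two lifts of a product of
    two remainder monomials, each of degree at most L, so it is a relation of degree at most 2L. *)
Lemma liftM d c d' c' : in_cone 0 d c -> in_cone 0 d' c' ->
  in_ideal (lift d c * lift d' c' - lift (d + d') (c + c')).
Proof.
move=> h h'; have [le _] := cone_coord_rem degD_gt0 h.
have [le' _] := cone_coord_rem degD_gt0 h'.
have hr := rem_in_cone degD_gt0 h; have hr' := rem_in_cone degD_gt0 h'.
have hrr := in_coneD hr hr'; rewrite addn0 in hrr.
pose p i := (ray_quo d c i + ray_quo d' c' i)%N.
have ed : (d + d' = rem_degree d c + rem_degree d' c' + shift_degree p)%N.
  by rewrite /p shift_degreeD addnACA !subnK.
have ec : c + c' = rem_expo d c + rem_expo d' c' + shift_expo p.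
  by rewrite /p shift_expoD addrACA !subrK.
rewrite [lift (d + d') _](_ : _ = ray_lifts p * lift (rem_degree d c + rem_degree d' c') (rem_expo d c + rem_expo d' c')); last first.
  by rewrite ed ec lift_shift //; case: hrr.
rewrite {1 2}/lift mulrACA -ray_liftsD -mulrBr; apply: in_idealM.
have [H E] := mono_liftP hr; have [H' E'] := mono_liftP hr'.
apply: (@in_ideal_relation _ (rem_degree d c + rem_degree d' c')).
- by rewrite rmorphB rmorphM /= E E' ev_lift // (monoD f_irr) subrr.
- by apply: rpredB; [apply: dhomogM|apply: lift_homog].
- apply: le_trans M_2L; rewrite ler_nat mul2n -addnn leq_add //.
    exact: (rem_degree_le f_irr f_hom degD_gt0 h).
  exact: (rem_degree_le f_irr f_hom degD_gt0 h').
Qed.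


Lemma M_ge_total : L%:R <= M.
Proof. by apply: le_trans M_2L; rewrite ler_nat leq_pmull. Qed.

(* Congruence to a combination of lifted monomials, modulo relations of degree <= M. *)
Inductive lift_span (d : nat) : W -> Prop :=
| lift_span_ideal Q of in_ideal Q : lift_span d Q
| lift_span_add c e Q of in_cone 0 d e & lift_span d Q : lift_span d (c *: lift d e + Q).

Lemma lift_spanD d P Q : lift_span d P -> lift_span d Q -> lift_span d (P + Q).
Proof.
move=> hP; elim=> [Q' iQ|c e Q' he _ IH]; last first.
  by rewrite addrCA; apply: lift_span_add.
elim: hP => [P' iP|c e P' he _ IH]; first by apply/lift_span_ideal/in_idealD.
by rewrite -addrA; apply: lift_span_add.
Qed.

Lemma lift_spanZ d c Q : lift_span d Q -> lift_span d (c *: Q).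
Proof.
elim=> [Q' iQ|c' e Q' he _ IH]; first by apply/lift_span_ideal/in_idealZ.
by rewrite scalerDr scalerA; apply: lift_span_add.
Qed.

Lemma lift_span_lift d e : in_cone 0 d e -> lift_span d (lift d e).
Proof.
move=> he; rewrite -[lift d e]addr0 -[lift d e]scale1r.
by apply/lift_span_add/lift_span_ideal/in_ideal0.
Qed.

Lemma lift_span_sum d (I : eqType) (l : seq I) (F : I -> W) :
  (forall i, i \in l -> lift_span d (F i)) -> lift_span d (\sum_(i <- l) F i).
Proof.
elim: l => [|i l IH] h; first by rewrite big_nil; apply/lift_span_ideal/in_ideal0.
rewrite big_cons; apply: lift_spanD; first by apply: h; rewrite mem_head.
by apply: IH => j jl; apply: h; rewrite inE jl orbT.
Qed.

Lemma lift_spanM d d' P Q : lift_span d P -> lift_span d' Q ->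
  lift_span (d + d') (P * Q).
Proof.
move=> hP hQ; elim: hP => [P' iP|c e P' he _ IH].
  by rewrite mulrC; apply/lift_span_ideal/in_idealM.
rewrite mulrDl; apply: lift_spanD => //; rewrite -scalerAl; apply: lift_spanZ.
elim: hQ => [Q' iQ|c' e' Q' he' _ IH']; first by apply/lift_span_ideal/in_idealM.
rewrite mulrDr; apply: lift_spanD => //; rewrite -scalerAr; apply: lift_spanZ.
rewrite -[lift d e * _](subrK (lift (d + d') (e + e'))).
apply: lift_spanD; first by apply/lift_span_ideal/liftM.
by apply: lift_span_lift; have := in_coneD he he'; rewrite addn0.
Qed.

Definition section_degree d : int := \sum_i floorD alpha d i * (a i)%:Z.

(** Sends a numerator monomial to the lift of its section; the value 0 on monomials of the wrong
    weight makes the map linear on all of [Y]. *)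
Definition lift_poly d : Y -> W := lin_ext (fun b =>
  if (wt a b)%:Z == section_degree d then lift d (expo_of alpha d b) else 0).
HB.instance Definition _ d := GRing.Linear.on (lift_poly d).

Lemma lift_polyX d b : (wt a b)%:Z = section_degree d ->
  lift_poly d 'X_[b] = lift d (expo_of alpha d b).
Proof. by move=> e; rewrite /lift_poly lin_extX e eqxx. Qed.

Lemma section_in_cone d b : (wt a b)%:Z = section_degree d ->
  in_cone 0 d (expo_of alpha d b).
Proof. by move=> e; apply: expo_of_in_cone; rewrite addr0. Qed.

Lemma lift_span_section d p :
  (forall b, b \in msupp p -> (wt a b)%:Z = section_degree d) ->
  [/\ lift_span d (lift_poly d p), lift_poly d p \is d.-homog for (wt dg) &
      ev (lift_poly d p) = eval_section d p].
Proof.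
move=> hp; have e : lift_poly d p = \sum_(b <- msupp p) p@_b *: lift d (expo_of alpha d b).
  by apply: eq_big_seq => b /hp ->; rewrite eqxx.
rewrite e; split.
- by apply: lift_span_sum => b /hp hb; apply/lift_spanZ/lift_span_lift/section_in_cone.
- rewrite big_seq; apply: rpred_sum => b /hp hb.
  by apply/rpredZ/lift_homog/section_in_cone.
- rewrite rmorph_sum (eval_section_sum alpha f_irr) big_seq [RHS]big_seq.
  apply: eq_bigr => b /hp hb.
  by rewrite [LHS]evZ (ev_lift (section_in_cone hb)).
Qed.

(** The generator g_j is a combination of monomial sections of degree [dg j], so its variable
    differs from the corresponding combination of lifts by a relation of degree at most L. *)
Lemma lift_span_var j : lift_span (dg j) 'X_j.
Proof.
have [gR [_ [c ec]]] := g_hom j.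
have [p ep hp] := RD_component f_irr f_hom f_na s_hom s_free (dg j) gR.
have [sp hom evp] := lift_span_section hp.
rewrite -['X_j](subrK (lift_poly (dg j) p)); apply: lift_spanD; last exact: sp.
apply/lift_span_ideal/(@in_ideal_relation _ (dg j)).
- rewrite rmorphB /= evp -ep ec coefCM coefXn eqxx mulr1 -ec.
  by rewrite /ev mmapX mmap1U subrr.
- by apply: rpredB; [rewrite dhomogX /= wt1|exact: hom].
- by apply: le_trans M_ge_total; rewrite ler_nat generator_degree_le.
Qed.

Lemma lift_span1 : lift_span 0 1.
Proof.
have h0 : in_cone 0 0 0.
  split=> [|i]; last by rewrite /cone_coord ffunE mul0r addr0.
  by rewrite big1 // => i _; rewrite ffunE mul0r.
rewrite -[1](subrK (lift 0 0)); apply: lift_spanD; last exact: lift_span_lift.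
apply/lift_span_ideal/(@in_ideal_relation _ 0%N).
- by rewrite rmorphB rmorph1 /= (ev_lift h0) (mono0 f) subrr.
- by apply: rpredB; [exact: dhomog1|exact: lift_homog].
- exact: le_trans (ler0n _ _) M_2L.
Qed.

Lemma lift_span_homog d Q : Q \is d.-homog for (wt dg) -> lift_span d Q.
Proof.
move=> /dhomogP hQ; rewrite (mpolyE Q); apply: lift_span_sum => b bQ.
apply: lift_spanZ; rewrite -(hQ _ bQ) mpolyXE_id /= /wt.
apply: (big_rec2 (fun (p : W) d => lift_span d p)); first exact: lift_span1.
move=> j e p _ hp; apply: lift_spanM => //.
elim: (b j) => [|i IH]; first exact: lift_span1.
by rewrite exprS mulSn; apply: lift_spanM => //; apply: lift_span_var.
Qed.

(** Transfers the problem from [W] to [Y]: a relation Q yields a polynomial p that vanishes at the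
    forms. *)
Lemma lift_span_poly d Q : lift_span d Q -> exists p : Y,
  in_ideal (Q - lift_poly d p) /\ ev Q = eval_section d p.
Proof.
elim=> [Q' iQ|c e Q' he _ [p [ip ep]]].
  exists 0; split; first by rewrite [lift_poly d 0]raddf0 subr0.
  by rewrite (in_ideal_ev iQ) [RHS]raddf0.
have [b eb hb] := in_coneP he; rewrite addr0 in hb.
exists (c *: 'X_[b] + p); split.
  rewrite linearD linearZ /= lift_polyX // -eb.
  by rewrite opprD addrACA subrr add0r.
rewrite rmorphD raddfD /= ep evZ (ev_lift he) eb.
by rewrite (eval_sectionZ f alpha) (eval_sectionX alpha f_irr).
Qed.

(* A multiple of a form that vanishes at f is, in each degree, a combination of
   ray lifts times relations of degree at most M. *)
Lemma lift_poly_relation d i (q : Y) b : q \is (a i).-homog for (wt a) ->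
  eval_forms f q = 0 -> in_ideal (lift_poly d (q * 'X_[b])).
Proof.
move=> /dhomogP hq q0.
have eq1 : lift_poly d (q * 'X_[b]) = \sum_(t <- msupp q) q@_t *: lift_poly d 'X_[t + b].
  rewrite {1}(mpolyE q) mulr_suml raddf_sum; apply: eq_bigr => t _.
  by rewrite -scalerAl -mpolyXD [LHS]linearZ.
(* If [q * 'X_[b]] does not have the weight of a numerator in degree d, [lift_poly d] sends all its
   terms to 0. *)
rewrite eq1; have [eb|nb] := eqVneq ((wt a b)%:Z + (a i)%:Z) (section_degree d); last first.
  rewrite big_seq big1; first exact: in_ideal0.
  move=> t /hq ht; rewrite /lift_poly lin_extX wtD.
  have -> : wt a t = a i by [].
  by rewrite PoszD addrC (negPf nb) scaler0.
(* The exponent [c] has defect a_i, and each monomial t of q fills it. Reducing [c] before adding t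
   gives all terms the same ray factor. *)
pose c := expo_of alpha d b; pose hat (t : 'X_{1..n.+1}) : expo := [ffun j => (t j)%:Z].
have hc : in_cone (a i) d c by apply: expo_of_in_cone.
have hr := rem_in_cone degD_gt0 hc.
have hcone t : t \in msupp q -> in_cone 0 (rem_degree d c) (rem_expo d c + hat t).
  move=> /hq ht; have [wr r0] := hr; split=> [|j]; last first.
    rewrite /cone_coord [(_ + hat t) j]ffunE [hat t j]ffunE intrD addrAC.
    exact: addr_ge0 (r0 j) (ler0n _ _).
  under eq_bigr do rewrite ffunE mulrDl; rewrite big_split /= wr.
  have -> : \sum_j hat t j * (a j)%:Z = (wt a t)%:Z.
    by rewrite /wt (big_morph Posz PoszD (erefl _)); apply: eq_bigr => j _; rewrite ffunE.
  have -> : wt a t = a i by [].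
  by rewrite addNr.
have -> : \sum_(t <- msupp q) q@_t *: lift_poly d 'X_[t + b] = ray_lifts (ray_quo d c) *
    \sum_(t <- msupp q) q@_t *: lift (rem_degree d c) (rem_expo d c + hat t).
  rewrite mulr_sumr; apply: eq_big_seq => t tq; rewrite -scalerAr -(lift_rem hc); last first.
    by move=> j; rewrite ffunE.
  congr (_ *: _); rewrite lift_polyX; last first.
    rewrite wtD; have -> : wt a t = a i by exact: hq.
    by rewrite PoszD addrC.
  by congr lift; apply/ffunP => j; rewrite !ffunE mnmDE PoszD [RHS]addrAC [(b j)%:Z + _]addrC.
apply: in_idealM; apply: (@in_ideal_relation _ (rem_degree d c)).
(* The offset [z] does not depend on t, so the sum is [eval_section] of q times the single Laurent
   monomial [mono 0 z], and vanishes with q at the forms. *)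
- pose z : expo := [ffun j => rem_expo d c j + floorD alpha (rem_degree d c) j].
  have em t : mono (rem_degree d c) (rem_expo d c + hat t) =
      mono (rem_degree d c) (expo_of alpha (rem_degree d c) t) * mono 0 z.
    rewrite -(monoD f_irr) addn0; congr (mono _ _); apply/ffunP => j.
    by rewrite /z /hat /expo_of !ffunE [RHS]addrACA addNr addr0 addrC.
  rewrite rmorph_sum; transitivity (eval_section (rem_degree d c) q * mono 0 z).
    rewrite (eval_section_sum alpha f_irr) mulr_suml; apply: eq_big_seq => t tq.
    by rewrite [LHS]evZ (ev_lift (hcone _ tq)) em mulrA.
  have e0 : tofrac (eval_forms f q) * fpow f (fun j => - floorD alpha (rem_degree d c) j) = 0 :> K.
    by rewrite q0 tofrac0 mul0r.
  by rewrite /eval_section e0 polyC0 !mul0r.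
- by rewrite big_seq; apply: rpred_sum => t /hcone ht; apply/rpredZ/lift_homog.
- apply: ltW; apply: lt_le_trans (M_form i).
  exact: (rem_bound (form_degree_gt0 f_irr f_hom) degD_gt0 hc).
Qed.

(* The kernel of evaluation at f is generated by the y_i - phi (f_i). *)
Lemma lift_poly_kernel d (p : Y) : eval_forms f p = 0 -> in_ideal (lift_poly d p).
Proof.
have [phi [phiC phiK phiH]] := eval_forms_section f_irr f_hom s_hom s_free.
pose theta (q : Y) : Y := phi (eval_forms f q).
(* The multiplier G makes the set of good A closed under products, since A B - theta(A B) = (A -
   theta A) B + (B - theta B) theta A. The claim follows with G = 1, as [theta p] is 0. *)
suff H : forall A G : Y, in_ideal (lift_poly d ((A - theta A) * G)).
  by move=> p0; have := H p 1; rewrite mulr1 /theta p0 rmorph0 subr0.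
have thetaD A B : theta (A + B) = theta A + theta B by rewrite /theta !rmorphD.
have thetaM A B : theta (A * B) = theta A * theta B by rewrite /theta !rmorphM.
have thetaC c : theta c%:MP = c%:MP by rewrite /theta /eval_forms mmapC phiC.
have HC c G : in_ideal (lift_poly d ((c%:MP - theta c%:MP) * G)).
  by rewrite thetaC subrr mul0r raddf0; apply: in_ideal0.
have HM A B : (forall G, in_ideal (lift_poly d ((A - theta A) * G))) ->
    (forall G, in_ideal (lift_poly d ((B - theta B) * G))) ->
    forall G, in_ideal (lift_poly d ((A * B - theta (A * B)) * G)).
  move=> hA hB G; rewrite thetaM.
  have -> : (A * B - theta A * theta B) * G =
    (A - theta A) * (B * G) + (B - theta B) * (theta A * G) by ring.
  by rewrite raddfD; apply: in_idealD; [exact: hA|exact: hB].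
have HX i G : in_ideal (lift_poly d (('X_i - theta 'X_i) * G)).
  rewrite [G]mpolyE mulr_sumr raddf_sum; apply: in_ideal_sum => b _.
  rewrite -scalerAr [X in in_ideal X]linearZ; apply/in_idealZ/(@lift_poly_relation _ i).
    apply: rpredB; first by rewrite dhomogX /= wt1.
    by rewrite /theta /eval_forms mmapX mmap1U; apply/phiH/f_hom.
  by rewrite rmorphB /= /theta phiK subrr.
have H1 G : in_ideal (lift_poly d ((1 - theta 1) * G)).
  by have := HC 1 G; rewrite mpolyC1.
elim/mpolyind => [|c b A _ _ IH] G; first by have := HC 0 G; rewrite mpolyC0.
rewrite thetaD opprD addrACA mulrDl raddfD; apply: in_idealD; last exact: IH.
rewrite -mul_mpolyC; apply: (HM c%:MP); [exact: HC|move=> {}G].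
rewrite mpolyXE_id; move: G.
apply: (big_ind (fun A => forall G, in_ideal (lift_poly d ((A - theta A) * G)))).
- exact: H1.
- exact: HM.
move=> i _; elim: (b i) => [|j IHj]; first exact: H1.
by rewrite exprS; apply: HM; [exact: HX|exact: IHj].
Qed.

(** Each homogeneous component is again a relation and is congruent to some [lift_poly d p]; its
    value being 0, p vanishes at the forms and [lift_poly_kernel] applies. *)
Lemma relations_generated Q : ev Q = 0 -> in_ideal Q.
Proof.
move=> Q0; rewrite [Q](@pihomog_partitionE _ _ (wt dg) _ _ (leqnn _)).
apply: in_ideal_sum => d _.
have hd : ev (pihomog (wt dg) d Q) = 0 by rewrite ev_pihomog Q0 coef0 mul0r.
have [p [ip ep]] := lift_span_poly (lift_span_homog (pihomogP (wt dg) d Q)).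
rewrite -[pihomog _ _ _](subrK (lift_poly d p)); apply: in_idealD => //.
apply: lift_poly_kernel; move: ep; rewrite hd /eval_section => /esym/eqP.
have Xd : 'X^d != 0 :> {poly K} by rewrite monic_neq0 // monicXn.
rewrite mulf_eq0 (negPf Xd) orbF polyC_eq0 mulf_eq0 tofrac_eq0.
by rewrite (negPf (fpow_neq0 f_irr _)) orbF => /eqP.
Qed.

End Relations.

Theorem theorem1p2 (k : closedFieldType) (m n : nat)
  (f : 'I_n.+1 -> {mpoly k[m.+1]}) (a : 'I_n.+1 -> nat) (alpha : 'I_n.+1 -> rat) :
  (1 <= m)%N ->
  (forall i, mirreducible (f i)) ->
  (forall i, f i \is (a i).-homog) ->
  (forall i j, i != j -> ~ massoc (f i) (f j)) ->
  0 < \sum_(i < n.+1) alpha i * (a i)%:R ->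
  (exists s : 'I_m.+1 -> 'I_n.+1,
      (forall j, f (s j) \is 1%N.-homog) /\
      (forall c : 'I_m.+1 -> k, \sum_(j < m.+1) c j *: f (s j) = 0 -> forall j, c j = 0)) ->
  let ell (i : 'I_n.+1) : nat :=
    \big[lcmn/1%N]_(j < n.+1 | j != i) `|denq (alpha j)|%N in
  let L : nat := (\sum_(i < n.+1) ell i * a i)%N in
  let degD : rat := \sum_(i < n.+1) alpha i * (a i)%:R in
  let M : rat :=
    Num.max (2 * L)%N%:R ((\max_(i < n.+1) a i)%N%:R / degD + L%:R) in
  (* R_D is generated in degrees at most L *)
  (forall P : {poly Kfield k m}, in_RD f alpha P ->
     in_kalg (fun x : {poly Kfield k m} => in_RD f alpha x /\ exists d, (d <= L)%N /\ homog_deg x d) P)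
  /\
  (* for a minimal set of homogeneous generators g_1..g_r (deg g_j = dg j),
     the kernel of k[w_1..w_r] -> R_D is generated by homogeneous elements
     of (weighted) degree at most M *)
  (forall (r : nat) (g : 'I_r -> {poly Kfield k m}) (dg : 'I_r -> nat),
     (forall j, in_RD f alpha (g j) /\ g j != 0 /\ homog_deg (g j) (dg j)) ->
     (forall P, in_RD f alpha P -> in_kalg (fun x : {poly Kfield k m} => exists j, x = g j) P) ->
     (forall j0, ~ (forall P, in_RD f alpha P ->
                     in_kalg (fun x : {poly Kfield k m} => exists j, j != j0 /\ x = g j) P)) ->
     forall Q : {mpoly k[r]}, mmap (@kconst k m) g Q = 0 ->
       exists (s : nat) (h q : 'I_s -> {mpoly k[r]}),
         (forall t, mmap (@kconst k m) g (q t) = 0 /\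
                    exists e : nat, whomog dg (q t) e /\ e%:R <= M) /\
         Q = \sum_(t < s) h t * q t).
Proof.
move=> _ f_irr f_hom f_na degD_gt0 [s [s_hom s_free]] ell L degD M; split.
  by move=> P; apply: (RD_generated f_irr f_hom f_na degD_gt0 s_hom s_free).
move=> r g dg g_hom g_gen g_min Q Q0.
apply: (relations_generated f_irr f_hom f_na degD_gt0 s_hom s_free g_hom g_gen g_min (M := M)) => //.
  by rewrite /M le_max lexx.
move=> i; rewrite /M le_max; apply/orP; right.
rewrite lerD2r ler_pM2r ?invr_gt0 // ler_nat.
exact: (leq_bigmax i).
Qed.
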